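(* Let $T$ be a tree of order $n$ that is DLS, and let $r,s$ be natural numbers. Then the graph $T\cup rK_1\cup sK_2$ is DLS. Moreover, if $n$ is not divisible by $2$ and $s=1$, then $T\cup rK_1\cup sK_2$ is DQS.
   Context: All graphs are finite, simple and undirected. For a graph $G$ with adjacency matrix $A(G)$ and diagonal degree matrix $D(G)$, the Laplacian matrix is $L(G)=D(G)-A(G)$ and the signless Laplacian matrix is $Q(G)=D(G)+A(G)$; the multiset of eigenvalues of $L(G)$ (resp. $Q(G)$) is the $L$-spectrum (resp. $Q$-spectrum). A graph $G$ is DLS (resp. DQS) if every graph with the same $L$-spectrum (resp. $Q$-spectrum) as $G$ is isomorphic to $G$. $K_m$ denotes the complete graph on $m$ vertices, $\cup$ denotes disjoint union, and $rK_1$ (resp. $sK_2$) denotes the disjoint union of $r$ copies of $K_1$ (resp. $s$ copies of $K_2$). *)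

(* Defs.v *)
From mathcomp Require Import all_boot all_order all_algebra all_field.

Set Implicit Arguments.
Unset Strict Implicit.
Unset Printing Implicit Defensive.

Import GRing.Theory.
Local Open Scope ring_scope.

Record sgraph : Type := SGraph {
  vertex : finType;
  edge : rel vertex;
  edge_sym : symmetric edge;
  edge_irr : irreflexive edge }.

Definition graph_order (G : sgraph) : nat := #|vertex G|.

Definition isomorphic (G H : sgraph) : Prop :=
  exists2 f : vertex G -> vertex H,
    bijective f & {mono f : x y / edge x y}.

Definition connected (G : sgraph) : Prop :=
  (0 < graph_order G)%N /\ forall x y : vertex G, connect (@edge G) x y.

(* A duplicate-free closed walk of size at most 2 is empty or runs back and
   forth along one edge; the genuine cycles are those of size at least 3. *)
Definition acyclic (G : sgraph) : Prop :=
  forall c : seq (vertex G), ucycle (@edge G) c -> (size c <= 2)%N.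

Definition is_tree (G : sgraph) : Prop := connected G /\ acyclic G.

Section CompleteGraph.
Variable m : nat.
Definition complete_edge : rel 'I_m := [rel i j | i != j].
Lemma complete_sym : symmetric complete_edge.
Proof. by move=> i j; rewrite /complete_edge /= eq_sym. Qed.
Lemma complete_irr : irreflexive complete_edge.
Proof. by move=> i; rewrite /complete_edge /= eqxx. Qed.
Definition complete : sgraph := SGraph complete_sym complete_irr.
End CompleteGraph.

Section DisjointUnion.
Variables G H : sgraph.
Definition dunion_edge : rel (vertex G + vertex H) := fun u v =>
  match u, v with
  | inl x, inl y => edge x y
  | inr x, inr y => edge x y
  | _, _ => false
  end.
Lemma dunion_sym : symmetric dunion_edge.
Proof. by case=> x [] y //=; rewrite edge_sym. Qed.
Lemma dunion_irr : irreflexive dunion_edge.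
Proof. by case=> x /=; rewrite edge_irr. Qed.
Definition dunion : sgraph := SGraph dunion_sym dunion_irr.
End DisjointUnion.

Section Copies.
Variables (k : nat) (G : sgraph).
Definition copies_edge : rel ('I_k * vertex G) :=
  [rel u v | (u.1 == v.1) && edge u.2 v.2].
Lemma copies_sym : symmetric copies_edge.
Proof. by move=> u v; rewrite /copies_edge /= eq_sym edge_sym. Qed.
Lemma copies_irr : irreflexive copies_edge.
Proof. by move=> u; rewrite /copies_edge /= edge_irr andbF. Qed.
Definition copies : sgraph := SGraph copies_sym copies_irr.
End Copies.

Section GraphMatrices.
Variable G : sgraph.

Definition degree (x : vertex G) : nat := #|[set y | edge x y]|.

Definition adjacency_mx : 'M[algC]_(graph_order G) :=
  \matrix_(i, j) (edge (enum_val i) (enum_val j))%:R.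

Definition degree_mx : 'M[algC]_(graph_order G) :=
  diag_mx (\row_i (degree (enum_val i))%:R).

Definition laplacian : 'M[algC]_(graph_order G) := degree_mx - adjacency_mx.

Definition signless_laplacian : 'M[algC]_(graph_order G) :=
  degree_mx + adjacency_mx.

End GraphMatrices.

(* The eigenvalues with multiplicity, listed in an arbitrary order: only
   [perm_eq] comparisons of spectra are meaningful. *)
Definition spectrum (n : nat) (A : 'M[algC]_n) : seq algC :=
  sval (closed_field_poly_normal (char_poly A)).

Lemma spectrumE (n : nat) (A : 'M[algC]_n) :
  char_poly A = \prod_(a <- spectrum A) ('X - a%:P).
Proof.
rewrite /spectrum; case: closed_field_poly_normal => s /= {1}->.
by rewrite (monicP (char_poly_monic A)) scale1r.
Qed.

Lemma mem_spectrum (n : nat) (A : 'M[algC]_n) (a : algC) :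
  (a \in spectrum A) = eigenvalue A a.
Proof. by rewrite eigenvalue_root_char spectrumE root_prod_XsubC. Qed.

Definition DLS (G : sgraph) : Prop :=
  forall H : sgraph,
    perm_eq (spectrum (laplacian H)) (spectrum (laplacian G)) ->
    isomorphic H G.

Definition DQS (G : sgraph) : Prop :=
  forall H : sgraph,
    perm_eq (spectrum (signless_laplacian H))
            (spectrum (signless_laplacian G)) ->
    isomorphic H G.

(* Main.v *)
(* Let H be L-cospectral with G, the union of T, r K_1 and s K_2.  Comparing the
   multiplicity of 0 and the trace, H is a forest with 1 + r + s components,
   whose orders have the product n 2^s of the lowest coefficients.  Mod 2, the
   Laplacian of a tree has corank one, so 2 is at most a simple eigenvalue of a
   tree, and then the order is even: s components can be flagged as
   of even order.  Dividing those orders by 2 leaves numbers 1 + b_i with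
   product n = 1 + sum 2^(u_i) b_i, where u_i is the flag.  This forces either a
   component of order n and all others K_1 or K_2, so that T being DLS
   concludes, or n = 9 and two components of order 6 with eigenvalue 2.  The
   latter case is excluded by the sum of (d-1)(d-2)(d-3) over all degrees d,
   which is a combination of the first three spectral moments.
     For Q and s = 1, det Q(C) is always divisible by 4, while 2n is not; hence 0
   is an eigenvalue of all components of H, the counting argument applies again,
   H is a forest, and L and Q are cospectral for forests. *)

From Stdlib Require List.
Require Import Defs.
From mathcomp Require Import all_boot all_order all_fingroup all_algebra all_field.
From mathcomp Require Import ring lra zify.

Set Implicit Arguments.
Unset Strict Implicit.
Unset Printing Implicit Defensive.
Import Order.TTheory GRing.Theory Num.Theory.
Local Open Scope ring_scope.

(** * Symmetric matrices *)

Lemma deriv_mulmx (R : comNzRingType) n (P Q : 'M[{poly R}]_n) :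
  map_mx (@deriv R) (P *m Q) =
  map_mx (@deriv R) P *m Q + P *m map_mx (@deriv R) Q.
Proof.
apply/matrixP=> i j; rewrite !mxE raddf_sum -big_split /=.
by apply: eq_bigr => k _; rewrite derivM !mxE.
Qed.

(** By symmetry, the diagonal entries of [B *m B] are the sums of squares of the rows of [B]. *)
Lemma sym_sqr_eq0 (R : realFieldType) n (B : 'M[R]_n) :
  B^T = B -> B *m B = 0 -> B = 0.
Proof.
move=> symB BB; apply/matrixP=> i j; rewrite mxE.
have /eqP := congr1 (fun M : 'M_n => M i i) BB; rewrite !mxE psumr_eq0.
  move=> /allP/(_ j); rewrite mem_index_enum => /(_ isT) /=.
  by rewrite -[B in X in _ * X]symB mxE mulf_eq0 orbb => /eqP.
by move=> k _; rewrite -{2}symB mxE -expr2 sqr_ge0.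
Qed.

Lemma eval_char_poly_mx (R : comNzRingType) n (A : 'M[R]_n) a :
  map_mx (horner_eval a) (char_poly_mx A) = a%:M - A.
Proof.
apply/matrixP=> i j; rewrite !mxE /horner_eval hornerD hornerN hornerC.
by rewrite hornerMn hornerX.
Qed.

Lemma horner_char_poly (R : comNzRingType) n (A : 'M[R]_n) a :
  (char_poly A).[a] = \det (a%:M - A).
Proof.
rewrite -eval_char_poly_mx det_map_mx; congr (_.[_]).
Qed.

(* Differentiating [(X - A) adj(X - A) = char_poly A] at a double root [a] gives
   [adj(a - A) = - (a - A) C], so [adj(a - A)] squares to [0]. *)
Lemma adj_double_root (R : realFieldType) n (A : 'M[R]_n) a :
  A^T = A -> ('X - a%:P) ^+ 2 %| char_poly A -> \adj (a%:M - A) = 0.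
Proof.
move=> symA /dvdpP[q Dq].
pose P := char_poly_mx A.
set B := \adj _.
have evP : map_mx (horner_eval a) P = a%:M - A := eval_char_poly_mx A a.
have evadj : map_mx (horner_eval a) (\adj P) = B by rewrite map_mx_adj evP.
have root1 : (char_poly A).[a] = 0.
  by rewrite Dq expr2 !hornerM hornerXsubC subrr !mulr0.
have root2 : (char_poly A)^`().[a] = 0.
  rewrite Dq expr2 !derivM !(hornerXsubC, hornerD, hornerM) subrr.
  by rewrite !(mul0r, mulr0, addr0).
have BA : B *m (a%:M - A) = 0.
  by rewrite mul_adj_mx -horner_char_poly root1 raddf0.
have dP : map_mx (@deriv R) P = 1%:M.
  apply/matrixP=> i j; rewrite !mxE derivB derivC subr0 derivMn derivX.
  by case: (i == j).
have := congr1 (fun M => map_mx (horner_eval a) (map_mx (@deriv R) M))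
  (mul_mx_adj P).
rewrite deriv_mulmx dP mul1mx map_mxD map_mxM evadj evP.
have -> : map_mx (horner_eval a) (map_mx (@deriv R) (\det P)%:M) = 0 :> 'M_n.
  apply/matrixP=> i j; rewrite !mxE /horner_eval.
  by case: (i == j); rewrite ?mulr1n ?mulr0n ?deriv0 ?horner0.
move/eqP; rewrite addr_eq0 => /eqP DB.
apply: sym_sqr_eq0.
  by rewrite /B trmx_adj linearB /= tr_scalar_mx symA.
by rewrite {2}DB mulmxN mulmxA BA mul0mx oppr0.
Qed.

(** Expand along row [i]: its cofactors do not see the perturbed entry. *)
Lemma det_add_delta (R : comNzRingType) n (A : 'M[R]_n) i c :
  \det (A + c *: delta_mx i i) = \det A + c * \adj A i i.
Proof.
rewrite !(expand_det_row _ i) mxE.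
have cof j : cofactor (A + c *: delta_mx i i) i j = cofactor A i j.
  rewrite /cofactor; congr (_ * \det _); apply/matrixP=> k l; rewrite !mxE.
  by rewrite eq_sym (negPf (neq_lift _ _)) mulr0 addr0.
under eq_bigr do rewrite cof mxE mulrDl.
rewrite big_split /=; congr (_ + _).
rewrite (bigD1 i) //= big1 ?addr0 => [|j nij].
  by rewrite !mxE !eqxx mulr1.
by rewrite !mxE (negPf nij) andbF mulr0 mul0r.
Qed.

(** The two sizes are only provably equal, as for the vertex enumerations of isomorphic graphs. The
    sign of the permutation occurs once for rows and once for columns. *)
Lemma char_poly_reindex (R : comNzRingType) m n (A : 'M[R]_m) (B : 'M[R]_n)
    (g : 'I_m -> 'I_n) :
  bijective g -> (forall i j, A i j = B (g i) (g j)) -> char_poly A = char_poly B.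
Proof.
move=> bij_g AB; have Emn : m = n.
  by rewrite -[m]card_ord -[n]card_ord; apply: bij_eq_card bij_g.
case: _ / Emn in B g bij_g AB *.
pose s := perm (bij_inj bij_g).
have -> : A = row_perm s (col_perm s B).
  by apply/matrixP=> i j; rewrite !mxE !permE AB.
rewrite /char_poly.
have -> : char_poly_mx (row_perm s (col_perm s B)) =
          row_perm s (col_perm s (char_poly_mx B)).
  by apply/matrixP=> i j; rewrite !mxE (inj_eq perm_inj).
rewrite row_permE col_permE !det_mulmx !det_perm odd_permV mulrC -mulrA.
by rewrite -signr_addb addbb mulr1.
Qed.

(* Leibniz: each term contains one entry of row [i] and one of column [i]. *)
Lemma dvdz4_det n (B : 'M[int]_n) i :
  (forall j, (2 %| B i j)%Z) -> (forall j, (2 %| B j i)%Z) ->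
  (4 %| B i i)%Z -> (4 %| \det B)%Z.
Proof.
move=> row_i col_i dii; apply: rpred_sum => s _; apply: dvdz_mull.
rewrite (bigD1 i) //=; have [si|nsi] := eqVneq (s i) i.
  by apply: dvdz_mulr; rewrite si.
have nvi : (s^-1)%g i != i by apply: contraNneq nsi => vi; rewrite -{1}vi permKV.
rewrite (bigD1 ((s^-1)%g i)) //= permKV mulrA; apply: dvdz_mulr.
by apply: (@dvdz_mul 2 2); [exact: row_i|exact: col_i].
Qed.

Lemma char_poly_similar (R : comNzRingType) n (A S S' : 'M[R]_n) :
  S *m S' = 1%:M -> char_poly (S *m A *m S') = char_poly A.
Proof.
move=> SS'; rewrite /char_poly.
pose T := map_mx (@polyC R) S; pose T' := map_mx (@polyC R) S'.
have TT' : T *m T' = 1%:M by rewrite -map_mxM SS' map_mx1.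
have -> : char_poly_mx (S *m A *m S') = T *m char_poly_mx A *m T'.
  rewrite /char_poly_mx !map_mxM mulmxBr mulmxBl; congr (_ - _).
  by rewrite scalar_mxC -mulmxA TT' mulmx1.
by rewrite !det_mulmx mulrAC -det_mulmx TT' det1 mul1r.
Qed.

(** A real symmetric matrix is normal, so the spectral theorem diagonalizes it, and the diagonal is
    a rearrangement of [s]. The iterate is the [k]-th power, meaningful also in size 0. *)
Lemma mxtrace_iter_roots n (A : 'M[algC]_n) (s : seq algC) k :
  A^T = A -> A \is a mxOver Num.real ->
  char_poly A = \prod_(a <- s) ('X - a%:P) ->
  \tr (iter k (mulmx A) 1%:M) = \sum_(a <- s) a ^+ k.
Proof.
move=> symA realA DA.
have /orthomx_spectralP : A \is normalmx.
  apply: symmetric_normalmx realA; apply/is_hermitianmxP.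
  by rewrite expr0 scale1r symA map_mx_id.
set P := spectralmx A; set sp := spectral_diag A => specA.
have unitP : P \in unitmx := spectral_unit A.
have sp_s : perm_eq [seq sp 0 i | i <- enum 'I_n] s.
  apply: prod_XsubC_eq; rewrite -DA specA char_poly_similar ?mulVmx //.
  rewrite char_poly_trig ?diag_mx_is_trig // big_map big_enum.
  by apply: eq_bigr => i _; rewrite mxE eqxx.
rewrite -(perm_big _ sp_s) big_map big_enum /=.
have -> : iter k (mulmx A) 1%:M =
          invmx P *m diag_mx (\row_i sp 0 i ^+ k) *m P.
  elim: k => [|k IHk] /=.
    have -> : \row_i sp 0 i ^+ 0 = const_mx 1 by apply/rowP=> i; rewrite !mxE.
    by rewrite diag_const_mx mulmx1 mulVmx.
  rewrite IHk [in X in X *m _]specA !mulmxA mulmxK //; congr (_ *m _).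
  rewrite -!mulmxA mulmx_diag; congr (_ *m diag_mx _).
  by apply/rowP=> i; rewrite !mxE exprS.
rewrite mxtrace_mulC mulmxA mulmxV // mul1mx mxtrace_diag.
by apply: eq_bigr => i _; rewrite mxE.
Qed.

(** * Laplacian matrices of connected graphs *)

(** One family for [L] ([b = false]) and [Q] ([b = true]). The ring varies because the same matrix
    is read over [rat], [int], [algC] and the prime fields. *)
Definition lapmx (R : comNzRingType) (b : bool) (G : sgraph) :
    'M[R]_(graph_order G) :=
  \matrix_(i, j) ((degree (enum_val i))%:R *+ (i == j)
                  - (-1) ^+ b * (edge (enum_val i) (enum_val j))%:R).

Definition phi (b : bool) (G : sgraph) : {poly rat} := char_poly (lapmx rat b G).

Lemma laplacianE G : laplacian G = lapmx algC false G.
Proof.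
by apply/matrixP=> i j; rewrite !mxE mul1r.
Qed.

Lemma signless_laplacianE G : signless_laplacian G = lapmx algC true G.
Proof.
by apply/matrixP=> i j; rewrite !mxE expr1 mulN1r opprK.
Qed.

Lemma map_lapmx (R S : comNzRingType) (f : {rmorphism R -> S}) b G :
  map_mx f (lapmx R b G) = lapmx S b G.
Proof.
by apply/matrixP=> i j;
  rewrite !mxE rmorphB rmorphMn rmorphM rmorph_sign !rmorph_nat.
Qed.

Lemma tr_lapmx (R : comNzRingType) b G : (lapmx R b G)^T = lapmx R b G.
Proof.
apply/matrixP=> i j; rewrite !mxE eq_sym edge_sym; congr (_ - _).
by have [->|] := eqVneq i j; rewrite ?mulr0n.
Qed.

Lemma map_phi b G :
  map_poly ratr (phi b G) = char_poly (lapmx algC b G).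
Proof. by rewrite map_char_poly (map_lapmx (@ratr algC)). Qed.

Lemma phi_monic b G : phi b G \is monic. Proof. exact: char_poly_monic. Qed.

Lemma phi_neq0 b G : phi b G != 0. Proof. exact: monic_neq0 (phi_monic b G). Qed.

Lemma size_phi b G : size (phi b G) = (graph_order G).+1.
Proof. exact: size_char_poly. Qed.

(** Cospectrality becomes an equality of rational polynomials, whose root multiplicities and
    coefficients can then be compared. *)
Lemma cospectral_phi b G H :
  perm_eq (spectrum (lapmx algC b H)) (spectrum (lapmx algC b G)) <->
  phi b H = phi b G.
Proof.
split=> [eqs|eqphi].
  apply: (map_poly_inj (@ratr algC)); rewrite !map_phi !spectrumE.
  exact: perm_big.
by apply: prod_XsubC_eq; rewrite -!spectrumE -!map_phi eqphi.
Qed.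

Lemma degree_sum (R : pzSemiRingType) (G : sgraph) (x : vertex G) :
  (degree x)%:R = \sum_y (edge x y)%:R :> R.
Proof.
rewrite /degree -sum1_card natr_sum big_mkcond /=.
by apply: eq_bigr => y _; rewrite inE; case: ifP.
Qed.

Lemma degree_iso G H (f : vertex G -> vertex H) x :
  bijective f -> {mono f : x y / edge x y} -> degree (f x) = degree x.
Proof.
move=> bij_f mono_f; rewrite /degree -!sum1_card (reindex f) /=; last exact:
  onW_bij.
by apply: eq_bigl => y; rewrite !inE mono_f.
Qed.

Lemma phi_iso b G H : isomorphic G H -> phi b G = phi b H.
Proof.
case=> f bij_f mono_f.
apply: (@char_poly_reindex _ _ _ _ _ (fun i => enum_rank (f (enum_val i)))).
  apply: bij_comp (enum_rank_bij _) _; apply: bij_comp bij_f (enum_val_bij _).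
move=> i j; rewrite !mxE !enum_rankK mono_f (degree_iso _ bij_f mono_f).
by rewrite (inj_eq enum_rank_inj) (inj_eq (bij_inj bij_f)) (inj_eq enum_val_inj).
Qed.

Lemma degree_dunionl G H (x : vertex G) :
  degree (inl x : vertex (dunion G H)) = degree x.
Proof.
rewrite /degree -!sum1_card big_mkcond [RHS]big_mkcond big_sumType /= [X in (_ +
  X)%N]big1.
  by rewrite addn0; apply: eq_bigr => y _; rewrite !inE.
by move=> y _; rewrite inE.
Qed.

Lemma degree_dunionr G H (x : vertex H) :
  degree (inr x : vertex (dunion G H)) = degree x.
Proof.
rewrite /degree -!sum1_card big_mkcond [RHS]big_mkcond big_sumType /= [X in (X +
  _)%N]big1.
  by rewrite add0n; apply: eq_bigr => y _; rewrite !inE.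
by move=> y _; rewrite inE.
Qed.

(** Listing the vertices of [G] before those of [H] makes the matrix block diagonal. *)
Lemma phi_dunion b G H : phi b (dunion G H) = phi b G * phi b H.
Proof.
pose m := graph_order G; pose n := graph_order H.
pose g (k : 'I_(m + n)) : 'I_(graph_order (dunion G H)) :=
  enum_rank (match split k with
             | inl i => inl (enum_val i) | inr j => inr (enum_val j) end).
pose B := block_mx (lapmx rat b G) 0 0 (lapmx rat b H).
have -> : phi b G * phi b H = char_poly B.
  by rewrite /char_poly char_block_diag_mx det_ublock.
apply/esym; apply: (@char_poly_reindex _ _ _ _ _ g).
  apply: bij_comp (enum_rank_bij _) _.
  exists (fun u => match u with inl x => lshift n (enum_rank x : 'I_m)
                              | inr y => rshift m (enum_rank y : 'I_n) end).
    by move=> k; case: splitP => i Hi; apply: val_inj; rewrite /= enum_valK.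
  case=> x.
    by rewrite (unsplitK (inl _)) enum_rankK.
  by rewrite (unsplitK (inr _)) enum_rankK.
move=> i j; rewrite -[i]splitK -[j]splitK /g !unsplitK.
case: (split i) => i'; case: (split j) => j' /=;
  rewrite ?block_mxEul ?block_mxEur ?block_mxEdl ?block_mxEdr !mxE !enum_rankK
   (inj_eq enum_rank_inj) /= ?degree_dunionl ?degree_dunionr ?mulr0 ?mulr0n
     ?subr0 //.
  by rewrite -[inl _ == inl _]/(enum_val i' == enum_val j') (inj_eq enum_val_inj).
by rewrite -[inr _ == inr _]/(enum_val i' == enum_val j') (inj_eq enum_val_inj).
Qed.

Section KernelLap.
Variables (F : comNzRingType) (b : bool) (G : sgraph).
Variables (v : 'rV[F]_(graph_order G)).
Let V x := v 0 (enum_rank x).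

Lemma mul_lapmx x :
  (v *m lapmx F b G) 0 (enum_rank x) =
  \sum_(y | edge x y) (V x - (-1) ^+ b * V y).
Proof.
rewrite mxE (reindex (@enum_rank _)) /=; last exact/onW_bij/enum_rank_bij.
under eq_bigr do rewrite mxE !enum_rankK (inj_eq enum_rank_inj) mulrBr.
rewrite !sumrB; congr (_ - _).
  rewrite (bigD1 x) //= eqxx big1 ?addr0 => [|y /negPf->]; last by rewrite mulr0.
  by rewrite degree_sum mulr_sumr [RHS]big_mkcond; apply: eq_bigr => y _;
     case: edge; rewrite ?mulr1 ?mulr0.
rewrite [RHS]big_mkcond; apply: eq_bigr => y _; rewrite edge_sym mulrCA.
by case: edge; rewrite ?mulr1 ?mulr0.
Qed.

Lemma mul_lapmx_delta c r x :
  (v *m (lapmx F b G + c *: delta_mx (enum_rank r) (enum_rank r)))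
    0 (enum_rank x) =
  \sum_(y | edge x y) (V x - (-1) ^+ b * V y) + c * V r *+ (x == r).
Proof.
rewrite mulmxDr mxE mul_lapmx; congr (_ + _).
rewrite mxE (bigD1 (enum_rank r)) //= big1 ?addr0 => [|i /negPf ni].
  rewrite !mxE eqxx (inj_eq enum_rank_inj) mulrCA mulr_natr.
  by rewrite -mulrnAr.
by rewrite !mxE ni mulr0 mulr0.
Qed.

End KernelLap.

Lemma row_eq0 (F : comNzRingType) G (v : 'rV[F]_(graph_order G)) :
  (forall x, v 0 (enum_rank x) = 0) -> v = 0.
Proof. by move=> v0; apply/rowP=> i; rewrite mxE -[i]enum_valK v0. Qed.

(** The quadratic form of the matrix. Each edge is met from both ends, and adding the two
    contributions completes a square. *)
Lemma lap_quadratic (F : realDomainType) (b : bool) (G : sgraph) (V :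
  vertex G -> F) :
  (\sum_x V x * (\sum_(y | edge x y) (V x - (-1) ^+ b * V y))) *+ 2 =
  \sum_x \sum_(y | edge x y) (V x - (-1) ^+ b * V y) ^+ 2.
Proof.
rewrite mulr2n.
transitivity (\sum_x \sum_(y | edge x y) V x * (V x - (-1) ^+ b * V y)
            + \sum_x \sum_(y | edge x y) V y * (V y - (-1) ^+ b * V x)).
  congr (_ + _); first by apply: eq_bigr => x _; rewrite mulr_sumr.
  rewrite (exchange_big_dep xpredT) //=; apply: eq_bigr => x _; rewrite mulr_sumr.
  by apply: eq_bigl => y; rewrite edge_sym.
rewrite -big_split; apply: eq_bigr => x _; rewrite -big_split.
apply: eq_bigr => y _; rewrite sqrrB exprMn sqrr_sign /=; ring.
Qed.

Lemma connected_ind G (P : vertex G -> Prop) r :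
  connected G -> P r -> (forall x y, edge x y -> P x -> P y) -> forall x, P x.
Proof.
move=> [_ conG] Pr step x; have /connectP[p pathp ->] := conG r x.
elim: p r Pr pathp {x} => //= y p IHp r Pr /andP[ry] /IHp; apply.
exact: step Pr.
Qed.

(** Pairing the equations with [V] gives a vanishing sum of nonnegative terms. The value [c = 0]
    treats the kernel of the matrix itself, [c = 1] that of the matrix with its entry at [r]
    increased by 1. *)
Lemma lap_harmonic (F : realDomainType) (b : bool) (G : sgraph) c r (V :
  vertex G -> F) :
  0 <= c ->
  (forall x,
    \sum_(y | edge x y) (V x - (-1) ^+ b * V y) + c * V r *+ (x == r) = 0) ->
  (forall x y, edge x y -> V x = (-1) ^+ b * V y) /\ c * V r = 0.
Proof.
move=> c0 eqV.
have : \sum_x \sum_(y | edge x y) (V x - (-1) ^+ b * V y) ^+ 2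
     + c * V r ^+ 2 *+ 2 = 0.
  rewrite -lap_quadratic -mulrnDl.
  have -> : c * V r ^+ 2 = \sum_x V x * (c * V r *+ (x == r)).
    rewrite (bigD1 r) //= eqxx big1 ?addr0 => [|y /negPf->]; last by rewrite mulr0.
    by rewrite expr2 mulrCA.
  by rewrite -big_split /= big1 ?mul0rn // => x _; rewrite -mulrDr eqV mulr0.
have ge0 x : true -> 0 <= \sum_(y | edge x y) (V x - (-1) ^+ b * V y) ^+ 2.
  by move=> _; apply: sumr_ge0 => y _; rewrite sqr_ge0.
move=> /eqP; rewrite paddr_eq0; last 2 first.
- exact: sumr_ge0.
- by rewrite mulrn_wge0 // mulr_ge0 ?sqr_ge0.
case/andP; rewrite psumr_eq0 // => /allP sum0; rewrite mulrn_eq0 /= => cV.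
split=> [x y xy|].
  have /implyP/(_ isT) := sum0 x (mem_index_enum _).
  rewrite psumr_eq0 => [/allP/(_ y (mem_index_enum _))|z _]; last exact: sqr_ge0.
  by rewrite xy /= sqrf_eq0 subr_eq0 => /eqP.
by apply/eqP; move: cV; rewrite !mulf_eq0 orbb.
Qed.

(** A kernel vector vanishes at [r], and its zeros spread along edges. *)
Lemma det_lap_delta_neq0 (F : realFieldType) b G r :
  connected G ->
  \det (lapmx F b G + 1 *: delta_mx (enum_rank r) (enum_rank r)) != 0.
Proof.
move=> conG; apply/det0P => -[v v_neq0 /rowP vL]; case/eqP: v_neq0.
have [|E Vr] := @lap_harmonic F b G 1 r (fun x => v 0 (enum_rank x)) ler01.
  by move=> x; rewrite -mul_lapmx_delta vL mxE.
apply: row_eq0; apply: (connected_ind (r := r) conG); first by rewrite -[LHS]mul1r.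
by move=> x y xy Vx; rewrite (E y x) ?Vx ?mulr0 // edge_sym.
Qed.

Lemma det_sub_delta_eq0 (R : comNzRingType) n (A : 'M[R]_n) i :
  \adj A = 0 -> \det A = 0 -> \det (A - delta_mx i i) = 0.
Proof.
by move=> adj0 det0; rewrite -scaleN1r det_add_delta adj0 det0 mxE mulr0 addr0.
Qed.

Lemma det_oppr (R : comNzRingType) n (A : 'M[R]_n) :
  \det (- A) = (-1) ^+ n * \det A.
Proof. by rewrite -scaleN1r detZ. Qed.

(** At a double root 0 the adjugate vanishes, so changing one diagonal entry of the matrix leaves it
    singular, against [det_lap_delta_neq0]. *)
Lemma mup0_phi b G : connected G -> (mup 0 (phi b G) <= 1)%N.
Proof.
move=> conG; rewrite mup_leq ?phi_neq0 //; apply/negP => dvd2.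
have adj0 := adj_double_root (tr_lapmx rat b G) dvd2.
have det0 : \det (0%:M - lapmx rat b G) = 0.
  rewrite -horner_char_poly; case/dvdpP: dvd2 => q; rewrite -/(phi b G) => ->.
  by rewrite expr2 !hornerM hornerXsubC subrr !mulr0.
have /card_gt0P[r _] := conG.1.
have := det_sub_delta_eq0 (enum_rank r) adj0 det0.
rewrite raddf0 sub0r -opprD det_oppr => /eqP; rewrite mulf_eq0 signr_eq0 /=.
by rewrite -[delta_mx _ _]scale1r (negPf (det_lap_delta_neq0 _ _ r conG)).
Qed.

(** * Parent functions *)

Definition sum_degrees (G : sgraph) : nat := (\sum_(x : vertex G) degree x)%N.

(** Trees by edge count, since the sum of the degrees is the trace of [L] and of [Q], hence visible
    in the spectrum. *)
Definition tree_like (G : sgraph) : Prop :=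
  connected G /\ sum_degrees G = (graph_order G).-1.*2.

(** A rooted spanning tree: the depth [d] drops along [p], so iterating [p] from any vertex reaches
    [r]. *)
Definition parenting (G : sgraph) (r : vertex G) (p : vertex G -> vertex G)
    (d : vertex G -> nat) : Prop :=
  forall v, v != r -> edge v (p v) /\ d v = (d (p v)).+1.

Definition parent_edge (G : sgraph) (r : vertex G) (p : vertex G -> vertex G) :
    rel (vertex G) :=
  fun u v => (u != r) && (p u == v) || (v != r) && (p v == u).

(** A breadth-first tree: [d] is the distance to [r], and [p] picks a neighbour that is one step
    closer. *)
Lemma parenting_exists G r : connected G -> exists p d, @parenting G r p d.
Proof.
move=> [_ conG].
have ex v : exists k, [exists t : k.-tuple (vertex G),
  path (@edge G) v t && (last v t == r)].
  have /connectP[q pathq ->] := conG v r.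
  by exists (size q); apply/existsP; exists (in_tuple q); rewrite pathq /=.
pose d v := ex_minn (ex v).
have dP v q : path (@edge G) v q -> last v q = r -> (d v <= size q)%N.
  move=> pathq lastq; rewrite /d; case: ex_minnP => k _; apply.
  by apply/existsP; exists (in_tuple q); rewrite /= pathq lastq eqxx.
(* The default [v] only serves at the root: a shortest walk from another vertex begins with an edge
   to a closer one. *)
pose p v := odflt v [pick y | edge v y & d v == (d y).+1].
exists p, d => v nvr; rewrite /p; case: pickP => [y /andP[vy /eqP dy] //|no].
have : exists2 q, path (@edge G) v q && (last v q == r) & size q = d v.
  rewrite /d; case: ex_minnP => k /existsP[t Ht] _.
  by exists t; rewrite ?size_tuple.
case=> -[|y q] /=; first by rewrite (negPf nvr).
case/andP=> /andP[vy pathq] /eqP lastq sz.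
have /negP[] := no y; rewrite vy /= eqn_leq -{2}sz ltnS dP // andbT.
have : exists2 q, path (@edge G) y q && (last y q == r) & size q = d y.
  rewrite /d; case: ex_minnP => k /existsP[t Ht] _.
  by exists t; rewrite ?size_tuple.
case=> q' /andP[pathq' /eqP lastq'] <-.
by apply: (dP v (y :: q')); rewrite //= vy.
Qed.

Section Parenting.
Variables (G : sgraph) (r : vertex G) (p : vertex G -> vertex G).
Variables (d : vertex G -> nat) (par : parenting r p d).

Let up := [set (v, p v) | v in [set~ r]].
Let down := [set (p v, v) | v in [set~ r]].

Lemma parent_edgeE u v : parent_edge r p u v = ((u, v) \in up :|: down).
Proof.
rewrite in_setU; congr (_ || _); apply/andP/imsetP => [[nr /eqP pu]|[w]].
- by exists u; rewrite ?inE // pu.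
- by rewrite !inE => nr [-> ->].
- by exists v; rewrite ?inE // pu.
- by rewrite !inE => nr [-> ->].
Qed.

(** The two orientations are disjoint: a pair lying in both would have each end one deeper than the
    other. *)
Lemma card_parent_edges : #|up :|: down| = (graph_order G).-1.*2.
Proof.
rewrite cardsU (_ : up :&: down = set0) ?cards0 ?subn0.
  rewrite !card_in_imset ?cardsC1 ?addnn //.
    by move=> u v _ _ [].
  by move=> u v _ _ [].
apply/setP=> -[u v]; rewrite !inE; apply/negP => /andP[/imsetP[x]].
rewrite !inE => nx [-> ->] /imsetP[y]; rewrite !inE => ny [xy yx].
have [_ dx] := par nx; have [_ dy] := par ny.
by move: dx dy; rewrite yx -xy => -> /eqP; lia.
Qed.

Lemma parent_edge_sub u v : parent_edge r p u v -> edge u v.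
Proof.
case/orP=> /andP[/par[e _] /eqP<- //].
by rewrite edge_sym.
Qed.

Lemma card_edges : sum_degrees G = #|[set e : vertex G * vertex G | edge e.1 e.2]|.
Proof.
transitivity (\sum_(x : vertex G) \sum_(y | edge x y) 1)%N.
  apply: eq_bigr => x _; rewrite /degree -sum1_card.
  by apply: eq_bigl => y; rewrite inE.
rewrite pair_big_dep -sum1_card /=.
by apply: eq_bigl => e; rewrite inE.
Qed.

Lemma leq_sum_degrees : ((graph_order G).-1.*2 <= sum_degrees G)%N.
Proof.
rewrite card_edges -card_parent_edges; apply: subset_leq_card.
by apply/subsetP => -[u v]; rewrite -parent_edgeE inE => /parent_edge_sub.
Qed.

(** Parent edges are edges, so equal cardinalities amount to equality of the two sets. *)
Lemma tight_parent_edge :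
  sum_degrees G = (graph_order G).-1.*2 <-> (forall u v,
    edge u v = parent_edge r p u v).
Proof.
rewrite card_edges -card_parent_edges; split=> [eqc u v|eqE].
  rewrite parent_edgeE; have /setP/(_ (u, v)) : up :|: down = [set e :
    vertex G * vertex G | edge e.1 e.2].
    apply/eqP; rewrite eqEcard eqc leqnn andbT.
    by apply/subsetP => -[x y]; rewrite -parent_edgeE inE => /parent_edge_sub.
  by rewrite inE /= => ->.
by apply: eq_card => -[u v]; rewrite -parent_edgeE inE eqE.
Qed.

Lemma parent_edge_sym : symmetric (parent_edge r p).
Proof. by move=> u v; rewrite /parent_edge orbC. Qed.

Lemma parent_ind (P : vertex G -> Prop) :
  P r -> (forall v, v != r -> P (p v) -> P v) -> forall v, P v.
Proof.
move=> Pr step v; move: {2}(d v) (leqnn (d v)) => k.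
elim: k v => [|k IHk] v; have [->//|nr] := eqVneq v r; have [_ ->] := par nr => //.
by rewrite ltnS => /IHk; apply: step.
Qed.

Lemma parent_connect u v : connect (parent_edge r p) u v.
Proof.
have toroot x : connect (parent_edge r p) x r.
  elim/parent_ind: x => // x nr; apply: connect_trans.
  by apply: connect1; rewrite /parent_edge nr eqxx.
apply: connect_trans (toroot u) _; rewrite sym_connect_sym //.
exact: parent_edge_sym.
Qed.

(** An edge from [u] to [v] closes a duplicate-free path of parent edges to a cycle. Acyclicity
    allows it two vertices at most, so the path is the single step from [u] to [v]. *)
Lemma acyclic_parent_edge :
  acyclic G -> forall u v, edge u v = parent_edge r p u v.
Proof.
move=> acyG u v; apply/idP/idP => [uv|]; last exact: parent_edge_sub.
have /connectP[q pathq Dv] := parent_connect u v.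
case/shortenP: pathq Dv => q' pathq' uniqq' _ Dv.
have := acyG (u :: q'); rewrite /ucycle uniqq' andbT /= rcons_path.
rewrite (sub_path parent_edge_sub pathq') -Dv edge_sym uv => /(_ isT).
case: q' pathq' Dv {uniqq'} => [_ /= vu|y [|//]];
  first by rewrite vu edge_irr in uv.
by rewrite /= andbT => uy ->.
Qed.

End Parenting.

Lemma is_tree_tree_like G : is_tree G -> tree_like G.
Proof.
move=> [conG acyG]; split=> //; have /card_gt0P[r _] := conG.1.
have [p [d par]] := parenting_exists r conG.
by apply/(tight_parent_edge par); apply: acyclic_parent_edge par acyG.
Qed.

Lemma connected_leq_sum_degrees G :
  connected G -> ((graph_order G).-1.*2 <= sum_degrees G)%N.
Proof.
move=> conG; have /card_gt0P[r _] := conG.1.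
by have [p [d par]] := parenting_exists r conG; apply: leq_sum_degrees par.
Qed.

Lemma tree_like_parent G r : tree_like G ->
  exists p d, @parenting G r p d /\ forall u v, edge u v = parent_edge r p u v.
Proof.
move=> [conG tightG]; have [p [d par]] := parenting_exists r conG.
by exists p, d; split=> //; apply/(tight_parent_edge par).
Qed.

(** * Laplacian spectra of trees *)

Lemma det_tree_delta_neq0 (F : fieldType) G r : tree_like G ->
  \det (lapmx F false G + 1 *: delta_mx (enum_rank r) (enum_rank r)) != 0.
Proof.
move=> treeG; have [p [d [par edgeE]]] := tree_like_parent r treeG.
apply/det0P => -[v v_neq0 /rowP vL]; case/eqP: v_neq0.
pose V x := v 0 (enum_rank x).
have eqV x : \sum_(y | edge x y) (V x - V y) + V r *+ (x == r) = 0.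
  have := vL (enum_rank x); rewrite mul_lapmx_delta mul1r [RHS]mxE => E;
    rewrite -[RHS]E.
  by congr (_ + _); apply: eq_bigr => y _; rewrite mul1r.
(* From the deepest vertices upwards, only the parent contributes. *)
have Vp x : x != r -> V x = V (p x).
  pose D := (\max_y d y)%N.
  have [k leDk] := ubnP (D - d x); elim: k x leDk => // k IHk x leDk nr.
  have := eqV x; rewrite (negPf nr) addr0 (bigD1 (p x)) /=; last exact:
    (par x nr).1.
  rewrite big1 ?addr0 => [/eqP|y]; first by rewrite subr_eq0 => /eqP.
  rewrite edgeE /parent_edge nr /= => /andP[/orP[/eqP->|]]; first by rewrite eqxx.
  case/andP=> nyr /eqP px _; apply/eqP; rewrite subr_eq0 eq_sym; apply/eqP.
  rewrite -px; apply: IHk (nyr); have := (par y nyr).2; rewrite px => dy.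
  have : (d y <= D)%N by apply: leq_bigmax.
  by move: leDk; rewrite dy; lia.
have Vr x : V x = V r by elim/(parent_ind par): x => // x /Vp->.
have := eqV r; rewrite eqxx big1 ?add0r => [Vr0|y _]; last by rewrite !Vr subrr.
by apply: row_eq0 => x; rewrite -/(V x) Vr.
Qed.

(** Every integer other than 1 and -1, including 0, has a prime divisor. *)
Lemma absz_eq1_Fp (z : int) :
  (forall q, prime q -> z%:~R != 0 :> 'F_q) -> `|z|%N = 1%N.
Proof.
move=> nz; apply/eqP; apply: contraT => nz1.
have [q pr_q dv] : exists2 q, prime q & (q %| `|z|)%N.
  case: (posnP `|z|%N) => [->|z_gt0]; first by exists 2%N.
  exists (pdiv `|z|%N); last exact: pdiv_dvd.
  by apply: pdiv_prime; lia.
have := nz q pr_q; rewrite -(dvdz_pcharf (pchar_Fp pr_q)).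
by rewrite dvdzE /= dv.
Qed.

(** The matrix-tree theorem for a graph with a single spanning tree: the determinant is nonzero
    modulo every prime. *)
Lemma absz_det_tree_delta G r : tree_like G ->
  `|\det (lapmx int false G + 1 *: delta_mx (enum_rank r) (enum_rank r))|%N = 1%N.
Proof.
move=> treeG; apply: absz_eq1_Fp => q pr_q.
have := det_tree_delta_neq0 'F_q r treeG.
set M := _ + _; rewrite (_ : M = map_mx intr (lapmx int false G + 1 *:
  delta_mx (enum_rank r) (enum_rank r))).
  by rewrite det_map_mx.
by rewrite map_mxD map_lapmx map_mxZ map_delta_mx.
Qed.

Lemma lapmx_ones (R : comNzRingType) G :
  lapmx R false G *m const_mx 1 = 0 :> 'cV_(graph_order G).
Proof.
apply: trmx_inj; rewrite trmx_mul tr_lapmx trmx_const trmx0.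
apply: row_eq0 => x; rewrite mul_lapmx big1 // => y _.
by rewrite !mxE mul1r subrr.
Qed.

(** This factors out the root 0. The all-ones vector is an eigenvector of [X - L] for [X];
    multiplying by the adjugate and reading row [i] gives the formula. *)
Lemma char_poly_lapmx (R : comNzRingType) G i :
  char_poly (lapmx R false G) =
  'X * \sum_j \adj (char_poly_mx (lapmx R false G)) i j.
Proof.
set Y := char_poly_mx _.
have Yones : Y *m const_mx 1 = 'X *: const_mx 1 :> 'cV_(graph_order G).
  rewrite /Y /char_poly_mx mulmxBl (map_lapmx polyC) lapmx_ones subr0.
  by rewrite mul_scalar_mx.
have := congr1 (mulmx (\adj Y)) Yones.
rewrite mulmxA mul_adj_mx mul_scalar_mx -scalemxAr => /colP/(_ i).
rewrite -[char_poly _]/(\det Y) !mxE mulr1 => ->; congr (_ * _).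
by apply: eq_bigr => j _; rewrite [const_mx _ _ _]mxE mulr1.
Qed.

(** As [det L = 0], the rows of the adjugate lie in the kernel of [L], which for a connected graph
    consists of constant vectors. *)
Lemma adj_lapmx_const G i j k : connected G ->
  \adj (0%:M - lapmx int false G) i j = \adj (0%:M - lapmx int false G) i k.
Proof.
move=> conG; set A := \adj _; pose v := row i A; pose V x := v 0 (enum_rank x).
have vL : v *m lapmx int false G = 0.
  have /card_gt0P[r _] := conG.1.
  have := mul_adj_mx (0%:M - lapmx int false G).
  rewrite -horner_char_poly (char_poly_lapmx _ (enum_rank r)) hornerM hornerX mul0r.
  rewrite !raddf0 sub0r mulmxN => /eqP; rewrite oppr_eq0 => /eqP AL.
  by rewrite /v -row_mul /A raddf0 sub0r AL row0.
have harm x : \sum_(y | edge x y) (V x - (-1) ^+ false * V y) +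
    0 * V (enum_val k) *+ (x == enum_val k) = 0.
  by rewrite mul0r mul0rn addr0 -mul_lapmx vL mxE.
have [E _] := lap_harmonic (lexx 0) harm.
suff : V (enum_val j) = V (enum_val k) by rewrite /V !enum_valK !mxE.
apply: (connected_ind (P := fun x => V x = V (enum_val k)) (r :=
  enum_val k) conG) => // x y /E.
by rewrite mul1r => ->.
Qed.

(** The coefficient is a row sum of the adjugate of [- L], with [n] equal entries. As [det L = 0],
    the diagonal entry is, up to sign, the determinant of [absz_det_tree_delta]. *)
Lemma coef1_char_poly_tree G : tree_like G ->
  absz (char_poly (lapmx int false G))`_1 = graph_order G.
Proof.
move=> treeG; have conG := treeG.1; have /card_gt0P[r _] := conG.1.
pose i := enum_rank r; rewrite (char_poly_lapmx _ i) coefXM /=.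
rewrite -horner_coef0 horner_sum.
have -> : \sum_j (\adj (char_poly_mx (lapmx int false G)) i j).[0] =
  \sum_(j < graph_order G) \adj (0%:M - lapmx int false G) i i.
  apply: eq_bigr => j _; rewrite -(adj_lapmx_const i j i conG) -eval_char_poly_mx.
  by rewrite -map_mx_adj [RHS]mxE.
rewrite sumr_const card_ord -mulr_natr natz abszM [absz (Posz _)]absz_nat.
suff -> : `|\adj (0%:M - lapmx int false G) i i|%N = 1%N by rewrite mul1n.
have := absz_det_tree_delta r treeG.
have := det_add_delta (0%:M - lapmx int false G) i (-1).
rewrite -horner_char_poly (char_poly_lapmx _ i) hornerM hornerX mul0r add0r mulN1r.
rewrite raddf0 sub0r scaleN1r -opprD -[delta_mx _ _]scale1r det_oppr => E.
have := congr1 absz E; rewrite abszM abszN abszX exp1n. by rewrite mul1n => <-;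
  rewrite scale1r.
Qed.

(** A double root 2 would make [2 - L] minus a diagonal unit singular. The determinant is an
    integer; modulo 2 the scalar 2 disappears and [det_tree_delta_neq0] is contradicted. *)
Lemma mup2_phi G : tree_like G -> (mup 2 (phi false G) <= 1)%N.
Proof.
move=> treeG; have conG := treeG.1; rewrite mup_leq ?phi_neq0 //;
  apply/negP => dvd2.
have adj0 := adj_double_root (tr_lapmx rat false G) dvd2.
have det0 : \det (2%:M - lapmx rat false G) = 0.
  rewrite -horner_char_poly; case/dvdpP: dvd2 => q; rewrite -/(phi _ G) => ->.
  by rewrite expr2 !hornerM hornerXsubC subrr !mulr0.
have /card_gt0P[r _] := conG.1.
have := det_sub_delta_eq0 (enum_rank r) adj0 det0.
rewrite (_ : 2%:M - _ - _ = map_mx intr (2%:M - lapmx int false G -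
  delta_mx (enum_rank r) (enum_rank r))); last first.
  by rewrite !map_mxB map_lapmx map_delta_mx map_scalar_mx.
rewrite det_map_mx => /eqP; rewrite intr_eq0 => /eqP.
move/(congr1 (intr : int -> 'F_2)); rewrite -det_map_mx !map_mxB map_lapmx.
rewrite map_delta_mx map_scalar_mx /=.
have -> : (2%:~R)%:M = 0 :> 'M['F_2]_(graph_order G).
  by rewrite (_ : 2%:~R = 0) ?raddf0 //; apply/eqP.
rewrite sub0r -opprD det_oppr => /eqP; rewrite mulf_eq0 signr_eq0 /=.
by rewrite -[delta_mx _ _]scale1r (negPf (det_tree_delta_neq0 _ r treeG)).
Qed.

Lemma phi_intr b G : phi b G = map_poly intr (char_poly (lapmx int b G)).
Proof. by rewrite map_char_poly map_lapmx. Qed.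

(** Write the characteristic polynomial as [X q] over the integers. Then [q(0)] is the order up to
    sign, and a root 2 of [q] splits off a factor [X - 2], making [q(0)] even. *)
Lemma even_order_root2 G : tree_like G -> root (phi false G) 2 ->
  ~~ odd (graph_order G).
Proof.
move=> treeG; rewrite phi_intr rootE -[2]/(2%:~R) horner_map intr_eq0.
have /card_gt0P[r _] := treeG.1.1.
have := coef1_char_poly_tree treeG.
rewrite (char_poly_lapmx _ (enum_rank r)); set q := \sum_j _.
rewrite hornerM hornerX mulf_eq0 /= => <- /factor_theorem[q' Dq].
rewrite coefXM /= Dq -horner_coef0 hornerM hornerXsubC sub0r abszM.
by rewrite oddM andbF.
Qed.

(** Conjugation by the signs of the depth parities turns [L] into [Q], because every edge changes
    the parity. *)
Lemma phi_bipartite G : tree_like G -> phi true G = phi false G.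
Proof.
move=> treeG; have /card_gt0P[r _] := treeG.1.1.
have [p [d [par edgeE]]] := tree_like_parent r treeG.
have flip x y : edge x y -> odd (d y) = ~~ odd (d x).
  rewrite edgeE => /orP[] /andP[/par[_ ->] /eqP->] //=.
  by rewrite negbK.
pose S : 'M[rat]_(graph_order G) := diag_mx (\row_i (-1) ^+ d (enum_val i)).
rewrite /phi -(@char_poly_similar _ _ (lapmx rat false G) S S).
  congr char_poly; apply/matrixP=> i j.
  rewrite mul_mx_diag mul_diag_mx !mxE; have [->|nij] := eqVneq i j.
    by rewrite edge_irr !mulr0 !subr0 mulrAC -expr2 sqrr_sign mul1r.
  rewrite !sub0r /= expr0 expr1 mulN1r mul1r opprK.
  case: (boolP (edge _ _)) => [/flip fl|_]; last by rewrite oppr0 mulr0 mul0r.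
  rewrite mulrN1 mulNr -!(signr_odd _ (d _)) fl -signr_addb.
  by case: odd; rewrite /= expr1 opprK.
rewrite mulmx_diag (_ : \row__ _ = const_mx 1) ?diag_const_mx //.
by apply/rowP=> i; rewrite !mxE -expr2 sqrr_sign.
Qed.

(** * Spectral moments and lowest coefficients *)

(** The spectral moments, attached to the polynomial rather than to the matrix so that they are
    shared by cospectral graphs and additive on products. *)
Definition psum (k : nat) (p : {poly rat}) : algC :=
  \sum_(a <- sval (closed_field_poly_normal (map_poly (@ratr algC) p))) a ^+ k.

Lemma roots_monic (p : {poly rat}) : p \is monic ->
  map_poly ratr p =
  \prod_(a <- sval (closed_field_poly_normal (map_poly (@ratr algC) p))) ('X -
    a%:P).
Proof.
move=> mon_p; case: closed_field_poly_normal => s /= {1}->.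
by rewrite (monicP _) ?scale1r // map_monic.
Qed.

Lemma psumM k (p q : {poly rat}) : p \is monic -> q \is monic ->
  psum k (p * q) = psum k p + psum k q.
Proof.
move=> mon_p mon_q; rewrite /psum -big_cat; apply: perm_big.
apply: prod_XsubC_eq; rewrite -roots_monic ?monicMl // rmorphM /=.
by rewrite big_cat /= -!roots_monic.
Qed.

Lemma psum_phi k b G :
  psum k (phi b G) = \tr (iter k (mulmx (lapmx algC b G)) 1%:M).
Proof.
apply/esym/mxtrace_iter_roots; rewrite ?tr_lapmx //.
  apply/mxOverP=> i j; rewrite mxE; apply: rpredB; first exact/rpredMn/realn.
  by apply: rpredM (realn _ _); apply: rpredX; rewrite rpredN rpred1.
by rewrite -map_phi; apply: roots_monic (phi_monic b G).
Qed.

Lemma mxtrace_sqrB (R : comNzRingType) n (D A : 'M[R]_n) :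
  \tr ((D - A) *m (D - A)) = \tr (D *m D) - \tr (D *m A) *+ 2 + \tr (A *m A).
Proof.
rewrite !(mulmxBl, mulmxBr) !raddfB /= (mxtrace_mulC A D).
ring.
Qed.

Lemma mxtrace_cube (R : comNzRingType) n (D A : 'M[R]_n) :
  \tr ((D - A) *m ((D - A) *m (D - A))) =
  \tr (D *m (D *m D)) - \tr (D *m (D *m A)) *+ 3 + \tr (D *m (A *m A)) *+ 3
  - \tr (A *m (A *m A)).
Proof.
rewrite !(mulmxBl, mulmxBr) !raddfB /=.
have -> : \tr (D *m (A *m D)) = \tr (D *m (D *m A)).
  by rewrite mulmxA mxtrace_mulC.
have -> : \tr (A *m (D *m D)) = \tr (D *m (D *m A)).
  by rewrite mxtrace_mulC mulmxA.
have -> : \tr (A *m (D *m A)) = \tr (D *m (A *m A)).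
  by rewrite mxtrace_mulC mulmxA.
have -> : \tr (A *m (A *m D)) = \tr (D *m (A *m A)).
  by rewrite mulmxA mxtrace_mulC.
ring.
Qed.

Section Traces.
Variables (R : comNzRingType) (G : sgraph).
Let D : 'M[R]_(graph_order G) := diag_mx (\row_i (degree (enum_val i))%:R).
Let A : 'M[R]_(graph_order G) := \matrix_(i, j) (edge (enum_val i) (enum_val j))%:R.

Lemma lapmx_DA b : lapmx R b G = D - (-1) ^+ b *: A.
Proof. by apply/matrixP=> i j; rewrite !mxE. Qed.

Lemma sum_vertices (f : vertex G -> R) :
  \sum_(i < graph_order G) f (enum_val i) = \sum_x f x.
Proof.
rewrite [RHS](reindex (@enum_val _ (vertex G))) //.
exact/onW_bij/enum_val_bij.
Qed.

Lemma mxtrace_diag_mul (u : 'rV[R]_(graph_order G)) M :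
  \tr (diag_mx u *m M) = \sum_i u 0 i * M i i.
Proof. by apply: eq_bigr => i _; rewrite mul_diag_mx mxE. Qed.

Lemma diag_A i : A i i = 0. Proof. by rewrite mxE edge_irr. Qed.

Lemma diag_AA i : (A *m A) i i = (degree (enum_val i))%:R.
Proof.
rewrite mxE degree_sum -sum_vertices; apply: eq_bigr => j _.
by rewrite !mxE [edge (enum_val j) _]edge_sym -natrM mulnb andbb.
Qed.

Lemma mxtrace_lapmx b : \tr (lapmx R b G) = \sum_(x : vertex G) (degree x)%:R.
Proof.
rewrite -sum_vertices; apply: eq_bigr => i _.
by rewrite mxE edge_irr mulr0 subr0 eqxx.
Qed.

Lemma mxtrace_lapmx_sqr b :
  \tr (lapmx R b G *m lapmx R b G) = \sum_(x :
    vertex G) ((degree x)%:R ^+ 2 + (degree x)%:R).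
Proof.
rewrite lapmx_DA mxtrace_sqrB -!scalemxAl -!scalemxAr !linearZ /= !mxtrace_diag_mul.
rewrite [\sum_i _ * A i i]big1 => [|i _]; last by rewrite diag_A mulr0.
rewrite mulr0 mul0rn subr0 mulrA -expr2 sqrr_sign mul1r -sum_vertices big_split.
congr (_ + _); first by apply: eq_bigr => i _; rewrite !mxE eqxx expr2.
by apply: eq_bigr => i _; rewrite diag_AA.
Qed.

(** The sign [b] survives only on the number of closed 3-walks; this lets a comparison of [L] with
    [Q] isolate that number. *)
Lemma mxtrace_lapmx_cube b :
  \tr (lapmx R b G *m (lapmx R b G *m lapmx R b G)) =
  \sum_(x : vertex G) ((degree x)%:R ^+ 3 + (degree x)%:R ^+ 2 *+ 3)
  - (-1) ^+ b * \tr (A *m (A *m A)).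
Proof.
rewrite lapmx_DA mxtrace_cube !(=^~ scalemxAl, =^~ scalemxAr) !linearZ /=.
rewrite [D *m (D *m A)]mulmxA mulmx_diag !mxtrace_diag_mul.
rewrite [\sum_i _ * A i i]big1 => [|i _]; last by rewrite diag_A mulr0.
rewrite mulr0 mul0rn subr0 !mulrA -expr2 sqrr_sign !mul1r; congr (_ - _).
rewrite -sum_vertices big_split /= -sumrMnl; congr (_ + _).
  by apply: eq_bigr => i _; rewrite !mxE eqxx mulr1n !exprS expr0 mulr1.
by apply: eq_bigr => i _; rewrite mxE diag_AA expr2.
Qed.
End Traces.

Lemma psum1_phi b G : psum 1 (phi b G) = (sum_degrees G)%:R.
Proof. by rewrite psum_phi /= mulmx1 mxtrace_lapmx natr_sum. Qed.

Lemma psum2_phi b G :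
  psum 2 (phi b G) = \sum_(x : vertex G) ((degree x)%:R ^+ 2 + (degree x)%:R).
Proof. by rewrite psum_phi /= mulmx1 mxtrace_lapmx_sqr. Qed.

Lemma psum3_phi_tree G : tree_like G ->
  psum 3 (phi false G) =
  \sum_(x : vertex G) ((degree x)%:R ^+ 3 + (degree x)%:R ^+ 2 *+ 3).
Proof.
(* L and Q are cospectral, and the numbers of closed 3-walks enter their third
   moments with opposite signs, hence vanish. *)
move=> treeG; have := psum_phi 3 true G;
  rewrite phi_bipartite // psum_phi /= !mulmx1.
rewrite !mxtrace_lapmx_cube expr1 expr0 mul1r mulN1r opprK.
set t := \tr _; move/addrI/eqP; rewrite eq_sym -addr_eq0 -mulr2n mulrn_eq0 /=.
by move/eqP=> ->; rewrite subr0.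
Qed.

(** For [p] nonzero, the lowest nonzero coefficient: for monic [p], up to sign, the product of the
    nonzero roots. *)
Definition low (p : {poly rat}) : rat := p`_(mup 0 p).

Lemma lowP p : p != 0 ->
  exists2 q, p = q * 'X ^+ mup 0 p & low p = q.[0] /\ ~~ root q 0.
Proof.
move=> p0; have := mup_geq 0 (mup 0 p) p0;
  rewrite leqnn polyC0 subr0 => /esym/dvdpP[q Dq].
exists q => //; split.
  by rewrite /low {1}Dq coefMXn ltnn subnn horner_coef0.
apply/negP => /factor_theorem[q' Dq']; have := mup_leq 0 (mup 0 p) p0.
by rewrite leqnn {2}Dq Dq' polyC0 subr0 -mulrA -exprS dvdp_mull.
Qed.

Lemma lowM p q : p != 0 -> q != 0 -> low (p * q) = low p * low q.
Proof.
move=> p0 q0; have [p' Dp [-> _]] := lowP p0; have [q' Dq [-> _]] := lowP q0.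
rewrite /low mupM // {1}Dp {1}Dq mulrACA -exprD coefMXn ltnn subnn.
by rewrite -horner_coef0 hornerM.
Qed.

Lemma mup0_connected G : connected G -> mup 0 (phi false G) = 1%N.
Proof.
move=> conG; have /card_gt0P[r _] := conG.1; apply/eqP.
rewrite eqn_leq mup0_phi //= -XsubC_dvd ?phi_neq0 // polyC0 subr0.
by rewrite /phi (char_poly_lapmx _ (enum_rank r)) dvdp_mulr.
Qed.

Lemma low_tree G : tree_like G -> `|low (phi false G)| = (graph_order G)%:R.
Proof.
move=> treeG; rewrite /low (mup0_connected treeG.1) -(coef1_char_poly_tree treeG).
by rewrite phi_intr coef_map /= natr_absz -intr_norm.
Qed.

(** Handshake lemma: swapping the ends exchanges the increasing and the decreasing ordered edges. *)
Lemma even_sum_degrees G : ~~ odd (sum_degrees G).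
Proof.
rewrite card_edges; set E := [set e | _].
pose L := [set e : vertex G * vertex G | enum_rank e.1 < enum_rank e.2]%N.
rewrite -(cardsID L E).
have -> : #|E :\: L| = #|E :&: L|.
  have swapI : injective (fun e : vertex G * vertex G => (e.2, e.1)).
    by move=> [a b] [c d] [-> ->].
  rewrite -(card_imset _ swapI); apply: eq_card => -[x y].
  rewrite !inE; apply/imsetP/idP => /= [[[u v]]|/andP[xy ltxy]].
    rewrite !inE /= => /andP[]; rewrite -leqNgt leq_eqVlt => ltuv uv [-> ->].
    rewrite edge_sym uv; case/orP: ltuv => // /eqP/ord_inj/enum_rank_inj vu.
    by rewrite vu edge_irr in uv.
  by exists (y, x); rewrite // !inE /= -leqNgt ltnW // edge_sym.
by rewrite addnn odd_double.
Qed.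

(** After the operations below, row and column [i] are even, and their common entry is twice the sum
    of the degrees, a multiple of 4. *)
Lemma dvdz4_det_signless G : (0 < graph_order G)%N ->
  (4 %| \det (lapmx int true G))%Z.
Proof.
case/card_gt0P=> r _; pose i := enum_rank r.
(* Add every column, then every row, to the one indexed by i. *)
pose U : 'M[int]_(graph_order G) := \matrix_(k, l) ((k == l) || (l == i))%:R.
have detU : \det U = 1.
  rewrite (expand_det_row _ i) (bigD1 i) //= big1 ?addr0 => [|j nij].
    rewrite mxE eqxx mul1r /cofactor -signr_odd addnn odd_double mul1r.
    rewrite (_ : row' i _ = 1%:M) ?det1 //; apply/matrixP=> k l.
    by rewrite !mxE (inj_eq lift_inj) [_ == i]eq_sym (negPf (neq_lift _ _)) orbF.
  by rewrite mxE eq_sym (negPf nij) mul0r.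
set Q := lapmx _ _ _; pose B := U^T *m (Q *m U).
have <- : \det B = \det Q by rewrite !det_mulmx det_tr detU mul1r mulr1.
have symB : B^T = B by rewrite /B !trmx_mul trmxK tr_lapmx mulmxA.
have QU k : (Q *m U) k i = (degree (enum_val k))%:R *+ 2.
  transitivity (((const_mx 1 : 'rV_(graph_order G)) *m Q) 0 k).
    rewrite !mxE; apply: eq_bigr => l _; rewrite !mxE eqxx orbT mulr1 mul1r.
    by rewrite edge_sym eq_sym; have [->|] := eqVneq l k; rewrite ?mulr0n.
  rewrite -[k]enum_valK mul_lapmx enum_rankK degree_sum -sumrMnl big_mkcond.
  by apply: eq_bigr => y _; rewrite !mxE expr1 mulN1r opprK; case: edge.
have Bi k : (2 %| B k i)%Z.
  rewrite mxE; apply: rpred_sum => l _; rewrite QU; apply: dvdz_mull.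
  by rewrite -mulr_natr dvdz_mull.
apply: (dvdz4_det (i := i)) => // [k|]; first by rewrite -symB mxE.
rewrite mxE (eq_bigr (fun k => (degree (enum_val k))%:R *+ 2)) => [|k _];
  last first.
  by rewrite QU !mxE eqxx orbT mul1r.
rewrite sumrMnl (sum_vertices (fun x => (degree x)%:R)) -natr_sum -/(sum_degrees G).
rewrite -(odd_double_half (sum_degrees G)) (negPf (even_sum_degrees G)) add0n.
by rewrite -mulrnA -muln2 -mulnA natrM dvdz_mull.
Qed.

Lemma low_signless_nonsingular G : (0 < graph_order G)%N ->
  mup 0 (phi true G) = 0%N -> exists k : nat, `|low (phi true G)| = (4 * k)%:R.
Proof.
move=> G0 mup0; have /dvdzP[z Dz] := dvdz4_det_signless G0.
exists `|z|%N; rewrite /low mup0 char_poly_det normrM normrX normrN1 expr1n mul1r.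
rewrite -(map_lapmx (intr :
  int -> rat)) det_map_mx Dz rmorphM normrM mulrC natrM natr_absz intr_norm.
by congr (_ * _); exact: normr_nat.
Qed.

(** * Connected components *)

Lemma iso_refl G : isomorphic G G.
Proof. by exists id => //; exists id. Qed.

Lemma iso_sym G H : isomorphic G H -> isomorphic H G.
Proof.
case=> f [g fK gK] mono_f; exists g; first by exists f.
by move=> x y; rewrite -mono_f !gK.
Qed.

Lemma iso_trans G H K : isomorphic G H -> isomorphic H K -> isomorphic G K.
Proof.
case=> f bij_f mono_f [g bij_g mono_g]; exists (g \o f); first exact: bij_comp.
by move=> x y; rewrite /= mono_g mono_f.
Qed.

Lemma dunion_iso G G' H H' :
  isomorphic G G' -> isomorphic H H' -> isomorphic (dunion G H) (dunion G' H').
Proof.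
case=> f [f' fK f'K] mono_f [g [g' gK g'K] mono_g].
exists (fun u : vertex (dunion G H) =>
          match u with inl x => inl (f x) | inr y => inr (g y) end
            : vertex (dunion G' H')).
  exists (fun u : vertex (dunion G' H') =>
          match u with inl x => inl (f' x) | inr y => inr (g' y) end).
    by case=> x; rewrite /= ?fK ?gK.
  by case=> x; rewrite /= ?f'K ?g'K.
by case=> x [] y //=; rewrite -?mono_f -?mono_g.
Qed.

Lemma dunionC G H : isomorphic (dunion G H) (dunion H G).
Proof.
pose swap (A B : sgraph) (u : vertex (dunion A B)) : vertex (dunion B A) :=
  match u with inl x => inr x | inr y => inl y end.
by exists (swap G H); [exists (swap H G) => -[] | case=> x [] y].
Qed.

Lemma dunionA G H K : isomorphic (dunion G (dunion H K)) (dunion (dunion G H) K).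
Proof.
exists (fun u : vertex (dunion G (dunion H K)) =>
  match u with
  | inl x => inl (inl x) | inr (inl y) => inl (inr y) | inr (inr z) => inr z
  end : vertex (dunion (dunion G H) K)).
  exists (fun u : vertex (dunion (dunion G H) K) =>
  match u with
  | inl (inl x) => inl x | inl (inr y) => inr (inl y) | inr z => inr (inr z)
  end); by [case=> [x|[y|z]] | case=> [[x|y]|z]].
by case=> [x|[x|x]] [y|[y|y]].
Qed.

Lemma dunionCA G H K : isomorphic (dunion G (dunion H K)) (dunion H (dunion G K)).
Proof.
apply: iso_trans (dunionA _ _ _) _; apply: iso_trans _ (iso_sym (dunionA _ _ _)).
exact: dunion_iso (dunionC _ _) (iso_refl _).
Qed.

Lemma dunion0 G H : graph_order H = 0%N -> isomorphic (dunion G H) G.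
Proof.
move=> /card0_eq H0.
have absurd (y : vertex H) : False by have := H0 y; rewrite inE.
exists (fun u : vertex (dunion G H) =>
  match u with inl x => x | inr y => match absurd y with end end).
  by exists (fun x => inl x : vertex (dunion G H)) => // -[x|y] //; case:
    (absurd y).
by case=> [x|x]; [case=> // y|]; case: (absurd _).
Qed.

(** [complete 0] is the empty graph, neutral for [dunion] up to isomorphism. *)
Definition unions : seq sgraph -> sgraph := foldr dunion (complete 0).

Lemma graph_order_complete m : graph_order (complete m) = m.
Proof. exact: card_ord. Qed.

Lemma graph_order_dunion G H :
  graph_order (dunion G H) = (graph_order G + graph_order H)%N.
Proof. exact: card_sum. Qed.

Lemma order0_iso G : graph_order G = 0%N -> isomorphic G (complete 0).
Proof.
move=> G0; apply: iso_trans _ (dunion0 (complete 0) G0).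
apply: iso_trans _ (dunionC _ _).
exact/iso_sym/dunion0/graph_order_complete.
Qed.

Lemma unions_cat s1 s2 :
  isomorphic (unions (s1 ++ s2)) (dunion (unions s1) (unions s2)).
Proof.
elim: s1 => [|C s1 IHs] /=; last first.
  exact: iso_trans (dunion_iso (iso_refl C) IHs) (dunionA _ _ _).
apply/iso_sym; apply: iso_trans (dunionC _ _) _.
exact/dunion0/graph_order_complete.
Qed.

(** The index type [I] lets the components carry flags. *)
Lemma unions_filter (I : Type) (f : I -> sgraph) (a : pred I) s :
  isomorphic (unions (map f s))
    (dunion (unions (map f (filter a s))) (unions (map f (filter (predC a) s)))).
Proof.
elim: s => [|i s IHs] /=; first exact/iso_sym/dunion0/graph_order_complete.
have step := dunion_iso (iso_refl (f i)) IHs.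
case: (a i) => /=; apply: iso_trans step _; first exact: dunionA.
exact: dunionCA.
Qed.

Lemma copies_unions k G : isomorphic (copies k G) (unions (nseq k G)).
Proof.
elim: k => [|k IHk].
  have c0 : graph_order (copies 0 G) = 0%N.
    by rewrite [LHS]card_prod card_ord.
  exact: order0_iso.
apply: iso_trans _ (dunion_iso (iso_refl G) IHk).
(* The copy with index 0 is split off; [unlift] renumbers the others. *)
exists (fun u : vertex (copies k.+1 G) =>
   (if unlift ord0 u.1 is Some j then inr (j, u.2) else inl u.2)
     : vertex (dunion G (copies k G))).
  exists (fun u : vertex (dunion G (copies k G)) =>
    match u with inl x => (ord0, x) | inr (j, x) => (lift ord0 j, x) end).
    by case=> i x /=; case: unliftP => [j|] ->.
  by case=> [x|[j x]] /=; rewrite ?unlift_none ?liftK.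
case=> [i x] [j y] /=.
case: (unliftP ord0 i) => [i'|] ->; case: (unliftP ord0 j) => [j'|] -> //=.
Qed.

Section Induced.
Variables (G : sgraph) (P : pred (vertex G)).

Definition induced_edge : rel {x | P x} := fun u v => edge (val u) (val v).

Lemma induced_sym : symmetric induced_edge.
Proof. by move=> u v; apply: edge_sym. Qed.

Lemma induced_irr : irreflexive induced_edge.
Proof. by move=> u; apply: edge_irr. Qed.

Definition induced : sgraph := SGraph induced_sym induced_irr.
End Induced.

Lemma induced_dunion G (P : pred (vertex G)) :
  (forall x y, edge x y -> P x = P y) ->
  isomorphic G (dunion (induced P) (induced (predC P))).
Proof.
move=> closedP; apply: iso_sym.
exists (fun u : vertex (dunion (induced P) (induced (predC P))) =>
          match u with inl x => val x | inr y => val y end).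
  exists (fun x => match boolP (P x) with
      | AltTrue Px => inl (exist _ x Px) | AltFalse nPx => inr (exist _ x nPx)
      end : vertex (dunion (induced P) (induced (predC P)))).
    case=> -[x Px] /=.
      case: {-}_ / boolP => [Px'|nPx]; last by case/negP: (nPx).
      by congr inl; apply: val_inj.
    case: {-}_ / boolP => [Px'|nPx]; first by case/negP: (Px).
    by congr inr; apply: val_inj.
  by move=> x; case: {-}_ / boolP.
case=> [[x Px]|[x Px]] [[y Py]|[y Py]] //=; apply/negP => /closedP.
  by rewrite Px (negPf Py).
by rewrite Py (negPf Px).
Qed.

Lemma connected_induced G r : connected (induced (connect (@edge G) r)).
Proof.
set C := induced _.
(* A walk of [G] starting in the component never leaves it, so it lifts. *)
have walk q (u : vertex C) : path (@edge G) (val u) q ->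
    exists2 v : vertex C, val v = last (val u) q & connect (@edge C) u v.
  elim: q u => [|y q IHq] u /=; first by exists u.
  case/andP=> uy; have Py : connect (@edge G) r y.
    exact: connect_trans (valP u) (connect1 uy).
  case/(IHq (exist _ y Py)) => v lastv uv; exists v => //.
  by apply: connect_trans uv; apply: connect1.
split.
  by apply/card_gt0P; exists (exist _ r (connect0 _ r)).
move=> u v; have symc : connect_sym (@edge G).
  by apply: sym_connect_sym; apply: edge_sym.
have : connect (@edge G) (val u) (val v).
  by apply: connect_trans (valP v); rewrite symc; apply: (valP u).
case/connectP=> q /walk[w wq uw] vq.
by rewrite (_ : v = w) //; apply: val_inj; rewrite wq.
Qed.

(** Induction on a bound for the order, peeling off the component of one vertex. *)
Lemma components n G : (graph_order G <= n)%N ->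
  exists2 cs, List.Forall connected cs & isomorphic G (unions cs).
Proof.
elim: n G => [|n IHn] G leGn.
  exists [::] => //; have G0 : graph_order G = 0%N by apply/eqP; rewrite -leqn0.
  exact: order0_iso.
have [G0|G_gt0] := posnP (graph_order G); first by apply: IHn; rewrite G0.
have /card_gt0P[r _] := G_gt0; pose P := connect (@edge G) r.
have symc : connect_sym (@edge G) by apply: sym_connect_sym; apply: edge_sym.
have isoG : isomorphic G (dunion (induced P) (induced (predC P))).
  apply: induced_dunion => x y xy; apply/idP/idP => /connect_trans; apply.
    exact: connect1.
  by apply: connect1; rewrite edge_sym.
have conP : connected (induced P) := connected_induced r.
have [|cs con_cs iso_cs] := IHn (induced (predC P)).
  have := conP.1; move: leGn; case: isoG => f /bij_eq_card; rewrite card_sum.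
  by rewrite /graph_order => -> _; lia.
exists (induced P :: cs); first by constructor.
exact: iso_trans isoG (dunion_iso (iso_refl _) iso_cs).
Qed.

Lemma complete_iso m G : graph_order G = m ->
  (forall x y : vertex G, edge x y = (x != y)) -> isomorphic G (complete m).
Proof.
move=> Gm eG; exists (fun x => cast_ord Gm (enum_rank x) : vertex (complete m)).
  apply: bij_comp (enum_rank_bij _).
  by exists (cast_ord (esym Gm)) => i; rewrite ?cast_ordK ?cast_ordKV.
by move=> x y;
  rewrite eG /= /complete_edge /= (inj_eq (@cast_ord_inj _ _ _)) (inj_eq
    enum_rank_inj).
Qed.

Lemma connected_order_le2 G m : connected G -> graph_order G = m -> (m <= 2)%N ->
  isomorphic G (complete m).
Proof.
move=> [_ conG] Gm le2; apply: complete_iso => // x y.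
have [->|nxy] := eqVneq x y; first by rewrite edge_irr.
have /connectP[[|z q] /=] := conG x y; first by move=> _ yx; rewrite yx eqxx in nxy.
case/andP=> xz _ _; suff -> : y = z by [].
apply/eqP; move: le2; rewrite -Gm; apply: contraTT => nyz; rewrite -ltnNge.
have uniq_xyz : uniq [:: x; y; z].
  rewrite /= !inE negb_or nxy nyz !andbT /=.
  by apply: contraTneq xz => ->; rewrite edge_irr.
by rewrite /graph_order -[3%N]/(size [:: x; y; z]) -(card_uniqP uniq_xyz) max_card.
Qed.

(** * Trees of order 6 and the sum-product equation *)

(** With a vertex [r] of degree at least 4, the tree is a star or a star with one edge prolonged. In
    both, the equations of an eigenvector for 2 have only the zero solution. *)
Lemma degree_le3 G : tree_like G -> graph_order G = 6 -> root (phi false G) 2 ->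
  forall x : vertex G, (degree x <= 3)%N.
Proof.
move=> treeG G6; rewrite rootE horner_char_poly => /det0P[v v_neq0 v2L] r.
rewrite leqNgt; apply/negP => deg_r; case/eqP: v_neq0; apply: row_eq0.
set V := fun x => v 0 (enum_rank x); rewrite -/V.
have vL : v *m lapmx rat false G = 2 *: v.
  by apply/esym/eqP; rewrite -subr_eq0 -mul_mx_scalar -mulmxBr v2L.
have E x : \sum_(y | edge x y) (V x - V y) = 2 * V x.
  have := mul_lapmx false v x; rewrite vL mxE -/(V x) => ->.
  by apply: eq_bigr => y _; rewrite mul1r.
(* At a leaf [x] with neighbour [z], the equation reads [V x - V z = 2 V x]. *)
have E1 x z : (forall y, edge x y = (y == z)) -> V x = - V z.
  by move=> xz; have := E x; rewrite (eq_bigl _ _ xz) big_pred1_eq; lra.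
have [p [d [par edgeE]]] := tree_like_parent r treeG.
have edge_r x : edge r x = (x != r) && (p x == r).
  by rewrite edgeE /parent_edge eqxx.
(* The vertices at depth at least 2; at most one, since [r] has at least 4 of the 5 other vertices
   as neighbours. *)
pose W := [set x | x != r & p x != r].
have cardW : (degree r + #|W| = 5)%N.
  have -> : 5%N = #|[set~ r]| by rewrite cardsC1 -/(graph_order G) G6.
  rewrite /degree.
  rewrite -(cardsID [set x | edge r x] [set~ r]); congr (_ + _)%N; apply:
    eq_card => x.
    by rewrite !inE edge_r andbA andbb.
  by rewrite !inE edge_r; case: (x != r); rewrite /= ?andbF ?andbT.
have leaf x : edge r x -> (forall w, w \in W -> p w != x) -> V x = - V r.
  rewrite edge_r => /andP[nxr /eqP pxr] noW; apply: E1 => y.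
  rewrite edgeE /parent_edge nxr pxr /= eq_sym.
  have [->//|nyr /=] := eqVneq y r; apply/negP => /eqP pyx.
  have : y \in W by rewrite inE nyr pyx.
  by move/noW; rewrite pyx eqxx.
have /orP[W0|/cards1P[w W1]] : (#|W| == 0) || (#|W| == 1%N) by lia.
  have noW x : x \in W = false by apply: card0_eq; apply/eqP.
  have leafN x : edge r x -> V x = - V r by move/leaf; apply=> w; rewrite noW.
  have Vr : V r = 0.
    have := E r; rewrite (eq_bigr (fun=> 2 * V r)) => [|y ry].
      rewrite sumr_const (eq_card (B := mem [set y | edge r y])) => [|y].
        rewrite -/(degree r); move/eqP: W0 cardW => ->; rewrite addn0 => ->.
        by rewrite -mulr_natr; lra.
      by rewrite !inE.
    by rewrite (leafN y ry); ring.
  move=> x; rewrite -/(V x); have [->//|nxr] := eqVneq x r.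
  rewrite leafN ?Vr ?oppr0 // edge_r nxr; apply: contraFT (noW x).
  by rewrite inE nxr.
(* The prolonged star: [w] hangs from the neighbour [u] of [r], and the three other neighbours of
   [r] are leaves. *)
have wW : w \in W by rewrite W1 inE.
have inW x : x \in W -> x = w by rewrite W1 inE => /eqP.
move: (wW); rewrite inE => /andP[nwr nur].
set u := p w in nur.
have pu : p u = r.
  apply: contraTeq isT => npu; have : u \in W by rewrite inE nur.
  by move/inW => uw; have := (par w nwr).2; rewrite -/u uw => /eqP; lia.
have ru : edge r u by rewrite edge_r nur pu eqxx.
have Vw : V w = - V u.
  apply: E1 => y; rewrite edgeE /parent_edge nwr /= -/u eq_sym.
  have [->//|nyu /=] := eqVneq y u; apply/negP => /andP[nyr /eqP pyw].
  have : y \in W by rewrite inE nyr pyw.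
  move/inW => yw; have := (par w nwr).2; rewrite -{2}yw pyw => /eqP; lia.
have Vu : V u = V r.
  have := E u; rewrite (bigD1 r) /= 1?edge_sym // (bigD1 w) /=; last first.
    by rewrite nwr andbT edgeE /parent_edge nwr eqxx orbT.
  rewrite big1 => [|y]; first by rewrite Vw; lra.
  rewrite edgeE /parent_edge nur pu /= => /andP[/andP[/orP[/eqP->|]]].
    by rewrite eqxx.
  case/andP=> nyr /eqP pyu _ nyw; have : y \in W by rewrite inE nyr pyu.
  by move/inW => yw; rewrite yw eqxx in nyw.
have leafN x : edge r x -> x != u -> V x = - V r.
  by move=> rx nxu; apply: leaf => // y /inW->; rewrite eq_sym.
have Vr : V r = 0.
  have := E r; rewrite (bigD1 u) //= Vu subrr add0r.
  rewrite (eq_bigr (fun=> 2 * V r)) => [|y /andP[ry nyu]];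
    last by rewrite (leafN y ry nyu); ring.
  have c3 : #|[set y | edge r y] :\ u| = 3%N.
    have := cardsD1 u [set y | edge r y]; rewrite inE ru -/(degree r) /= => deg4.
    by move: cardW; rewrite W1 cards1 deg4; lia.
  rewrite sumr_const (eq_card (B := [set y | edge r y] :\ u)) => [|y].
    by rewrite c3 -mulr_natr; lra.
  by rewrite !inE andbC.
move=> x; rewrite -/(V x); have [->//|nxr] := eqVneq x r.
have [xW|] := boolP (x \in W); first by rewrite (inW x xW) Vw Vu Vr oppr0.
rewrite inE nxr /= negbK => pxr; have [->|nxu] := eqVneq x u; first by rewrite Vu.
by rewrite leafN ?Vr ?oppr0 // edge_r nxr.
Qed.

(** For three parts, expand the product. A further factor [e.+1] adds [e] times the previous
    product, hence at least [2 * e]. *)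
Lemma prod_gt_sum (t : seq nat) : all (leq 1) t -> (2 < size t)%N ->
  (1 + 2 * \sum_(b <- t) b < \prod_(b <- t) b.+1)%N.
Proof.
case: t => [|a [|b [|c t]]] //= /and4P[a0 b0 c0 t0] _.
elim: t t0 => [|e t IHt] /=; rewrite !big_cons ?big_nil.
  by move=> _; nia.
case/andP=> e0 /IHt; rewrite !big_cons.
set S := (\sum_(_ <- _) _)%N; set P := (\prod_(_ <- _) _)%N.
move=> IH; have -> :
  (a.+1 * (b.+1 * (c.+1 * (e.+1 * P))) = e.+1 * (a.+1 * (b.+1 * (c.+1 * P))))%N.
  by lia.
by move: IH; set Q := (a.+1 * _)%N; nia.
Qed.

(* The weight 2 sits on the parts [b] coming from components with eigenvalue 2. *)
Lemma parts_cases (t : seq (nat * bool)) :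
  all (fun x => 0 < x.1)%N t ->
  (\prod_(x <- t) x.1.+1 = 1 + \sum_(x <- t) 2 ^ x.2 * x.1)%N ->
  [\/ t = [::], exists b, t = [:: (b, false)],
      exists b, t = [:: (b, true); (1, false)] \/ t = [:: (1, false); (b, true)]
    | t = [:: (2, true); (2, true)]]%N.
Proof.
case: t => [|[a u] [|[b u'] [|x t]]] /=.
- by move=> _ _; constructor 1.
- rewrite !big_seq1 /= andbT => a0 E; constructor 2; exists a.
  by case: u E => //=; rewrite expn1; lia.
- rewrite !(big_cons, big_nil) /= => /and3P[a0 b0 _] E.
  (* With flags read as 0 or 1, the equation is [a b = u a + u' b]: two flags give
     [(a - 1)(b - 1) = 1], one flag makes the unflagged part 1, and no flag is impossible. *)
  case: u u' E => -[] /=; rewrite ?expn1 ?expn0 ?muln1 ?mul1n ?addn0 => E.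
  + constructor 4; have [-> ->] // : a = 2%N /\ b = 2%N.
    have [a1|a_gt1] := leqP a 1; first by (have a1' : a = 1%N by lia); subst a; lia.
    have [b1|b_gt1] := leqP b 1; first by (have b1' : b = 1%N by lia); subst b; lia.
    by nia.
  + constructor 3; exists a; left; congr [:: _; (_, _)].
    by nia.
  + constructor 3; exists b; right; congr [:: (_, _); _].
    by nia.
  + by nia.
(* With three or more parts, weights of at most 2 cannot reach the product. *)
- move=> pos_t E; exfalso.
  have := @prod_gt_sum (map fst [:: (a, u), (b, u'), x & t]).
  rewrite all_map !big_map E => /(_ pos_t isT); rewrite ltnNge => /negP[].
  rewrite leq_add2l big_distrr /=; apply: leq_sum => y _.
  by case: y.2; rewrite ?expn1 ?expn0 ?mul1n ?leq_pmull.
Qed.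

(** * Unions of connected graphs *)

Lemma phi_order0 b G : graph_order G = 0%N -> phi b G = 1.
Proof.
move=> G0; have sz := size_phi b G; rewrite G0 in sz.
have Dphi := size1_polyC (eq_leq sz); have := phi_monic b G.
by rewrite monicE lead_coefE sz Dphi coefC /= => /eqP->.
Qed.

Lemma graph_order_unions cs :
  graph_order (unions cs) = (\sum_(C <- cs) graph_order C)%N.
Proof.
elim: cs => [|C cs IHcs] /=; first by rewrite big_nil graph_order_complete.
by rewrite big_cons graph_order_dunion IHcs.
Qed.

Lemma sum_degrees_dunion G H :
  sum_degrees (dunion G H) = (sum_degrees G + sum_degrees H)%N.
Proof.
rewrite /sum_degrees big_sumType /=.
by congr (_ + _)%N; apply: eq_bigr => x _; rewrite ?degree_dunionl ?degree_dunionr.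
Qed.

Lemma sum_degrees_leq_counts cs : List.Forall connected cs ->
  (2 * graph_order (unions cs) <= sum_degrees (unions cs) + 2 * size cs)%N.
Proof.
elim: cs => [|C cs IHcs] /=; first by rewrite graph_order_complete.
move=> all_con; have := IHcs (List.Forall_inv_tail all_con).
have conC := List.Forall_inv all_con; have := connected_leq_sum_degrees conC.
by have := conC.1; rewrite graph_order_dunion sum_degrees_dunion; lia.
Qed.

(** Each connected graph satisfies the inequality of [connected_leq_sum_degrees], so equality of the
    totals forces equality in every component. *)
Lemma tree_like_counts cs : List.Forall connected cs ->
  (sum_degrees (unions cs) + 2 * size cs = 2 * graph_order (unions cs))%N <->
  List.Forall tree_like cs.
Proof.
elim: cs => [|C cs IHcs] /=.
  move=> _; split=> // _; rewrite graph_order_complete /sum_degrees.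
  by rewrite big1 //; case.
move=> all_con; have con_cs := List.Forall_inv_tail all_con.
have conC := List.Forall_inv all_con; have := connected_leq_sum_degrees conC.
have := sum_degrees_leq_counts con_cs; have := conC.1.
rewrite graph_order_dunion sum_degrees_dunion => C0 leq_cs leq_C; split.
  move=> E; constructor; first by split=> //; lia.
  by apply/IHcs => //; lia.
move=> all_tree; have /IHcs-/(_ con_cs) := List.Forall_inv_tail all_tree.
by have [_] := List.Forall_inv all_tree; lia.
Qed.

Lemma phi_graph_order b G H : phi b G = phi b H -> graph_order G = graph_order H.
Proof. by move=> E; apply: succn_inj; rewrite -!(size_phi b) E. Qed.

Lemma phi_sum_degrees b G H : phi b G = phi b H -> sum_degrees G = sum_degrees H.
Proof.
by move=> E; apply/eqP; rewrite -(eqr_nat algC) -!(psum1_phi b) E.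
Qed.

Lemma Forall_tree_like_connected cs :
  List.Forall tree_like cs -> List.Forall connected cs.
Proof. by apply: List.Forall_impl => C []. Qed.

(** The degree of [phi] and the first moment determine the two totals in [tree_like_counts], for [L]
    and [Q] alike. *)
Lemma cospectral_tree_like b cs ds :
  List.Forall connected cs -> List.Forall tree_like ds -> size cs = size ds ->
  phi b (unions cs) = phi b (unions ds) -> List.Forall tree_like cs.
Proof.
move=> con_cs tree_ds szE E; apply/tree_like_counts => //.
have /tree_like_counts := tree_ds;
  rewrite (phi_graph_order E) (phi_sum_degrees E) szE.
by apply; apply: Forall_tree_like_connected.
Qed.

Lemma mup0_unions cs : List.Forall connected cs ->
  mup 0 (phi false (unions cs)) = size cs.
Proof.
elim: cs => [|C cs IHcs] /= all_con.
  by rewrite phi_order0 ?graph_order_complete // mupNroot // root1.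
rewrite phi_dunion mupM ?phi_neq0 // (mup0_connected (List.Forall_inv all_con)).
by rewrite IHcs //; apply: List.Forall_inv_tail all_con.
Qed.

Lemma low_unions cs : List.Forall tree_like cs ->
  `|low (phi false (unions cs))| = (\prod_(C <- cs) graph_order C)%:R.
Proof.
elim: cs => [|C cs IHcs] /= all_tree.
  rewrite big_nil phi_order0 ?graph_order_complete // /low mupNroot ?root1 //.
  by rewrite coefC normr1.
rewrite big_cons phi_dunion lowM ?phi_neq0 // normrM natrM.
rewrite (low_tree (List.Forall_inv all_tree)) IHcs //.
exact: List.Forall_inv_tail all_tree.
Qed.

Lemma phi_true_unions cs : List.Forall tree_like cs ->
  phi true (unions cs) = phi false (unions cs).
Proof.
elim: cs => [|C cs IHcs] /= all_tree;
  first by rewrite !phi_order0 ?graph_order_complete.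
rewrite !phi_dunion phi_bipartite ?IHcs //.
  exact: List.Forall_inv_tail all_tree.
exact: List.Forall_inv all_tree.
Qed.

Lemma low_phi_nat b G : exists k : nat, `|low (phi b G)| = k%:R.
Proof.
rewrite /low phi_intr coef_map /= -intr_norm.
by eexists; rewrite -natr_absz.
Qed.

(** A component with nonsingular [Q] would put a factor 4 into the lowest coefficient, the other
    factors being integers. So every component has 0 as a root, and it is simple. *)
Lemma mup0_signless_unions cs : List.Forall connected cs ->
  (forall k : nat, `|low (phi true (unions cs))| != (4 * k)%:R) ->
  mup 0 (phi true (unions cs)) = size cs.
Proof.
elim: cs => [|C cs IHcs] /= all_con.
  by rewrite phi_order0 ?graph_order_complete // mupNroot // root1.
rewrite phi_dunion lowM ?mupM ?phi_neq0 // normrM => not4.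
have conC := List.Forall_inv all_con.
have := mup0_phi true conC; rewrite leq_eqVlt ltnS leqn0 => /orP[/eqP->|/eqP mup0].
  rewrite IHcs //; first exact: List.Forall_inv_tail all_con.
  move=> k; apply/eqP => E; have [l El] := low_phi_nat true C.
  by have := not4 (l * k)%N; rewrite E El -natrM mulnCA eqxx.
have [k Ek] := low_signless_nonsingular conC.1 mup0.
have [l El] := low_phi_nat true (unions cs).
by have := not4 (k * l)%N; rewrite Ek El -natrM mulnA eqxx.
Qed.

Lemma connected_complete m : (0 < m)%N -> connected (complete m).
Proof.
move=> m0; split=> [|x y]; first by rewrite graph_order_complete.
have [->|nxy] := eqVneq x y; first exact: connect0.
exact: connect1.
Qed.

Lemma degree_complete m (x : vertex (complete m)) : degree x = m.-1.
Proof.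
rewrite /degree (_ : [set y | _] = [set~ x]) ?cardsC1 ?card_ord //.
by apply/setP=> y; rewrite !inE eq_sym.
Qed.

Lemma tree_like_complete m : (0 < m <= 2)%N -> tree_like (complete m).
Proof.
case/andP=> m0 m2; split; first exact: connected_complete.
rewrite graph_order_complete /sum_degrees.
rewrite (eq_bigr (fun=> m.-1)) => [|x _]; last exact: degree_complete.
by rewrite sum_nat_const card_ord; case: m m0 m2 => [|[|[|]]].
Qed.

Definition small (C : sgraph) : Prop := connected C /\ (graph_order C <= 2)%N.

Lemma small_unions cs : List.Forall small cs ->
  exists a b, [/\ isomorphic (unions cs)
      (dunion (unions (nseq a (complete 1))) (unions (nseq b (complete 2)))),
    size cs = (a + b)%N & graph_order (unions cs) = (a + 2 * b)%N].
Proof.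
elim: cs => [|C cs IHcs] all_small.
  exists 0%N, 0%N; split; rewrite //= ?graph_order_complete //.
  exact/iso_sym/dunion0/graph_order_complete.
have [a [b [iso_cs szE orderE]]] := IHcs (List.Forall_inv_tail all_small).
have [conC C2] := List.Forall_inv all_small.
have isoC := connected_order_le2 conC erefl C2.
have step := dunion_iso isoC iso_cs; rewrite /= graph_order_dunion orderE szE.
have := conC.1; case: (graph_order C) C2 step => [|[|[|]]] // _ step _.
  exists a.+1, b; split; [|lia|lia].
  exact: iso_trans step (dunionA _ _ _).
exists a, b.+1; split; [|lia|lia].
exact: iso_trans step (dunionCA _ _ _).
Qed.

(** The numbers [a] of [K_1] and [b] of [K_2] are determined by [a + b] and [a + 2b]. *)
Lemma small_iso cs ds : List.Forall small cs -> List.Forall small ds ->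
  size cs = size ds -> graph_order (unions cs) = graph_order (unions ds) ->
  isomorphic (unions cs) (unions ds).
Proof.
move=> /small_unions[a [b [iso_cs -> ->]]] /small_unions[a' [b' [iso_ds -> ->]]].
move=> szE orderE; apply: iso_trans iso_cs (iso_sym _).
by have [-> ->] : a = a' /\ b = b' by lia.
Qed.

(** The summand is -6 at degree 0, vanishes at degrees 1, 2, 3 and is positive from 4 on. *)
Definition psi (G : sgraph) : int :=
  \sum_(x : vertex G) ((degree x)%:R - 1) * ((degree x)%:R - 2) * ((degree x)%:R
    - 3).

Lemma psi_iso G H : isomorphic G H -> psi G = psi H.
Proof.
case=> f bij_f mono_f; rewrite /psi [RHS](reindex f) /=; last exact: onW_bij.
by apply: eq_bigr => x _; rewrite (degree_iso _ bij_f mono_f).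
Qed.

Lemma psi_dunion G H : psi (dunion G H) = psi G + psi H.
Proof.
rewrite /psi big_sumType /=.
by congr (_ + _); apply: eq_bigr => x _; rewrite ?degree_dunionl ?degree_dunionr.
Qed.

Lemma psi_complete m :
  psi (complete m) = ((m.-1)%:R - 1) * ((m.-1)%:R - 2) * ((m.-1)%:R - 3) *+ m.
Proof.
rewrite /psi (eq_bigr (fun=> ((m.-1)%:R - 1) * ((m.-1)%:R - 2) * ((m.-1)%:R - 3))).
  by rewrite sumr_const card_ord.
by move=> x _; rewrite degree_complete.
Qed.

Lemma psi_nseq k G : psi (unions (nseq k G)) = psi G *+ k.
Proof.
elim: k => [|k IHk] /=; first by rewrite psi_complete.
by rewrite psi_dunion IHk mulrS.
Qed.

Lemma psum_order0 k G : graph_order G = 0%N -> psum k (phi false G) = 0.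
Proof.
move=> G0; rewrite psum_phi /mxtrace big1 // => i _.
by have : (i < 0)%N by rewrite -[X in (_ < X)%N]G0 ltn_ord.
Qed.

(** Per vertex, [(d-1)(d-2)(d-3) = (d^3 + 3d^2) - 9(d^2 + d) + 20d - 6], where the brackets and [d]
    are the summands of the third, second and first moments. *)
Lemma psi_spectral cs : List.Forall tree_like cs ->
  (psi (unions cs))%:~R =
  psum 3 (phi false (unions cs)) - psum 2 (phi false (unions cs)) *+ 9
  + psum 1 (phi false (unions cs)) *+ 20 - (graph_order (unions cs))%:R *+ 6.
Proof.
elim: cs => [|C cs IHcs] all_tree.
  rewrite /= !psum_order0 ?graph_order_complete // psi_complete mulr0n.
  by rewrite !mul0rn !subr0 addr0.
have treeC := List.Forall_inv all_tree.
have IH := IHcs (List.Forall_inv_tail all_tree).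
rewrite /= psi_dunion graph_order_dunion phi_dunion !psumM ?phi_monic //.
rewrite rmorphD natrD /= IH.
suff -> : (psi C)%:~R = psum 3 (phi false C) - psum 2 (phi false C) *+ 9
  + psum 1 (phi false C) *+ 20 - (graph_order C)%:R *+ 6 by ring.
rewrite psum3_phi_tree // psum2_phi psum1_phi /sum_degrees natr_sum.
rewrite /graph_order -sum1_card natr_sum /psi rmorph_sum /= -!sumrMnl -!sumrB
  -big_split -sumrB.
apply: eq_bigr => x _ /=; rewrite !rmorphM !rmorphB /= !rmorph_nat; ring.
Qed.

(** * Comparing the components *)

Lemma connected_degree_gt0 G (x : vertex G) :
  connected G -> (1 < graph_order G)%N -> (0 < degree x)%N.
Proof.
move=> [_ conG] G1; have : (0 < #|[set~ x]|)%N by rewrite cardsC1 -subn1 subn_gt0.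
case/card_gt0P=> y; rewrite !inE => nyx.
have /connectP[[|z q] /=] := conG x y; first by move=> _ yx; rewrite yx eqxx in nyx.
by case/andP=> xz _ _; apply/card_gt0P; exists z; rewrite inE.
Qed.

Lemma psi_ge0 G : connected G -> (1 < graph_order G)%N -> 0 <= psi G.
Proof.
move=> conG G1; apply: sumr_ge0 => x _.
have := connected_degree_gt0 x conG G1; case: (degree x) => [|[|[|[|d]]]] // _.
by rewrite natz; apply: mulr_ge0; [apply: mulr_ge0|]; lia.
Qed.

Lemma psi_root2_order6 G : tree_like G -> graph_order G = 6 ->
  root (phi false G) 2 -> psi G = 0.
Proof.
move=> treeG G6 root2; apply: big1 => x _.
have := degree_le3 treeG G6 root2 x; have := connected_degree_gt0 x treeG.1.
by rewrite G6 => /(_ isT); case: (degree x) => [|[|[|[|d]]]].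
Qed.

Lemma root2_complete2 : root (phi false (complete 2)) 2.
Proof.
rewrite /phi -eigenvalue_root_char; apply/eigenvalueP.
pose v : 'rV[rat]_(graph_order (complete 2)) :=
  \row_i (-1) ^+ (enum_val i : 'I_2).
exists v; last first.
  apply/eqP => /rowP/(_ (enum_rank (ord0 : vertex (complete 2)))).
  by rewrite !mxE enum_rankK expr0 => /eqP; rewrite oner_eq0.
apply/rowP=> j; rewrite -[j]enum_valK mul_lapmx mxE big_mkcond.
rewrite !big_ord_recl big_ord0 !mxE !enum_rankK.
case: (enum_val j) => [[|[|]]] //= _; rewrite !mxE !enum_rankK /complete_edge /=;
  ring.
Qed.

(** More than [s] components may have the eigenvalue 2; exactly [s] flags are needed to cancel the
    factor [2 ^ s]. *)
Lemma choose_flags (I : Type) (P : pred I) s cs : (s <= count P cs)%N ->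
  exists l : seq (I * bool),
    [/\ map fst l = cs, count snd l = s & all (fun x => x.2 ==> P x.1) l].
Proof.
elim: cs s => [|C cs IHcs] s /=; first by rewrite leqn0 => /eqP->; exists [::].
have [PC|nPC] := boolP (P C); last first.
  rewrite add0n => /IHcs[l [Dl cnt fl]].
  by exists ((C, false) :: l); split; rewrite /= ?Dl ?cnt.
case: s => [_|s]; last first.
  rewrite add1n ltnS => /IHcs[l [Dl cnt fl]].
  by exists ((C, true) :: l); split; rewrite /= ?Dl ?cnt ?PC.
have [l [Dl cnt fl]] := IHcs 0%N (leq0n _).
by exists ((C, false) :: l); split; rewrite /= ?Dl ?cnt.
Qed.

Lemma mup2_unions cs : List.Forall tree_like cs ->
  mup 2 (phi false (unions cs)) = count (fun C => root (phi false C) 2) cs.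
Proof.
elim: cs => [|C cs IHcs] /= all_tree.
  by rewrite phi_order0 ?graph_order_complete // mupNroot // root1.
rewrite phi_dunion mupM ?phi_neq0 // IHcs; last exact:
  List.Forall_inv_tail all_tree.
congr (_ + _)%N; have := mup2_phi (List.Forall_inv all_tree).
rewrite -dvdp_XsubCl XsubC_dvd ?phi_neq0 //.
by case: (mup _ _) => [|[|]].
Qed.

(** The number [b] for which the order is [1 + b], or [2 (1 + b)] when flagged. For a flagged
    component in the sense below, [b = 0] means order 1 without the flag and order 2 with it. *)
Definition part (x : sgraph * bool) : nat := (graph_order x.1 %/ 2 ^ x.2).-1.

Definition flagged (x : sgraph * bool) : Prop :=
  [/\ tree_like x.1, x.2 -> root (phi false x.1) 2
    & graph_order x.1 = (2 ^ x.2 * (part x).+1)%N].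

Lemma Forall_flagged l : List.Forall tree_like (map fst l) ->
  all (fun x => x.2 ==> root (phi false x.1) 2) l -> List.Forall flagged l.
Proof.
elim: l => [|[C u] l IHl] //= all_tree /andP[/implyP rootC fl].
have treeC := List.Forall_inv all_tree.
constructor; last by apply: IHl => //; apply: List.Forall_inv_tail all_tree.
split=> //; rewrite /part /=; have C0 := treeC.1.1.
case: u rootC => rootC; last by rewrite expn0 divn1 mul1n prednK.
have := even_order_root2 treeC (rootC isT); move: C0; rewrite expn1.
by case: (graph_order C) => // m _ evm; lia.
Qed.

Lemma Forall_filter (I : Type) (P : I -> Prop) (a : pred I) s :
  List.Forall P s -> List.Forall (fun x => P x /\ a x) (filter a s).
Proof.
elim: s => [|x s IHs] //= all_P; have := IHs (List.Forall_inv_tail all_P).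
by case: ifP => // ax; constructor=> //; split=> //; apply: List.Forall_inv all_P.
Qed.

Lemma Forall_map (I J : Type) (f : I -> J) (P : J -> Prop) (Q : I -> Prop) s :
  (forall x, Q x -> P (f x)) -> List.Forall Q s -> List.Forall P (map f s).
Proof. by move=> QP; elim=> //= x l /QP Px _ IHl; constructor. Qed.

Lemma Forall_nseq (I : Type) (P : I -> Prop) k x : P x -> List.Forall P (nseq k x).
Proof. by move=> Px; elim: k => //= k IHk; constructor. Qed.

Lemma Forall_cat (I : Type) (P : I -> Prop) s1 s2 :
  List.Forall P s1 -> List.Forall P s2 -> List.Forall P (s1 ++ s2).
Proof. by elim=> //= x l Px _ IHl /IHl; constructor. Qed.

Lemma flagged_prod l : List.Forall flagged l ->
  (\prod_(x <- l) graph_order x.1 = 2 ^ count snd l * \prod_(x <- l) (part x).+1)%N.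
Proof.
elim: l => [|x l IHl] all_fl; first by rewrite !big_nil.
rewrite !big_cons IHl /=; last exact: List.Forall_inv_tail all_fl.
by have [_ _ ->] := List.Forall_inv all_fl; rewrite expnD mulnACA.
Qed.

(** Each order is [1 + u + 2^u b], with flag [u] and part [b]. *)
Lemma flagged_sum l : List.Forall flagged l ->
  (\sum_(x <- l) graph_order x.1 =
   size l + count snd l + \sum_(x <- l) 2 ^ x.2 * part x)%N.
Proof.
elim: l => [|x l IHl] all_fl; first by rewrite !big_nil.
rewrite !big_cons IHl /=; last exact: List.Forall_inv_tail all_fl.
have [_ _ ->] := List.Forall_inv all_fl.
by case: x.2 => /=; rewrite ?expn1 ?expn0; lia.
Qed.

Lemma map_pair_inv (l : seq (sgraph * bool)) a u c v :
  [seq (part x, x.2) | x <- l] = [:: (a, u); (c, v)] ->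
  exists x y, [/\ l = [:: x; y], part x = a /\ x.2 = u & part y = c /\ y.2 = v].
Proof. by case: l => [|x [|y [|]]] //= [? ? ? ?]; exists x, y. Qed.

Section Main.
Variables (T : sgraph) (r s : nat).
Hypothesis treeT : tree_like T.

Let n := graph_order T.
Let K1 := complete 1.
Let K2 := complete 2.
Let ds := T :: nseq r K1 ++ nseq s K2.
Let G := dunion (dunion T (copies r K1)) (copies s K2).

Lemma iso_G : isomorphic G (unions ds).
Proof.
apply: iso_trans (iso_sym (dunionA _ _ _)) _; apply: dunion_iso (iso_refl _) _.
apply: iso_trans _ (iso_sym (unions_cat _ _)).
exact: dunion_iso (copies_unions _ _) (copies_unions _ _).
Qed.

Lemma tree_ds : List.Forall tree_like ds.
Proof.
by constructor=> //; apply: Forall_cat; apply: Forall_nseq; apply: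
  tree_like_complete.
Qed.

Lemma small_tail : List.Forall small (nseq r K1 ++ nseq s K2).
Proof.
by apply: Forall_cat; apply: Forall_nseq; split;
  rewrite ?graph_order_complete //; apply: connected_complete.
Qed.

Lemma size_ds : size ds = (r + s).+1.
Proof. by rewrite /= size_cat !size_nseq. Qed.

Lemma order_tail : graph_order (unions (nseq r K1 ++ nseq s K2)) = (r + 2 * s)%N.
Proof.
rewrite graph_order_unions big_cat /= !big_nseq !iter_addn_0 !graph_order_complete.
by rewrite mul1n.
Qed.

Lemma prod_ds : (\prod_(C <- ds) graph_order C = n * 2 ^ s)%N.
Proof.
rewrite big_cons big_cat /= !big_nseq !graph_order_complete !iter_muln_1 exp1n.
by rewrite mul1n.
Qed.

(** Counting identifies the small components with those of the target. Cancelling their factor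
    leaves [C] cospectral with [T]. *)
Lemma split_iso H C cs : DLS T -> connected C -> graph_order C = n ->
  List.Forall small cs -> size cs = (r + s)%N ->
  isomorphic H (dunion C (unions cs)) -> phi false H = phi false (unions ds) ->
  isomorphic H (unions ds).
Proof.
move=> dlsT conC orderC small_cs szE isoH phiH.
have iso_tail : isomorphic (unions cs) (unions (nseq r K1 ++ nseq s K2)).
  apply: small_iso small_tail _ _ => //; first by rewrite szE size_cat !size_nseq.
  have := phi_graph_order phiH; rewrite (phi_graph_order (phi_iso false isoH)).
  by rewrite /= !graph_order_dunion orderC => /addnI.
have isoH' := iso_trans isoH (dunion_iso (iso_refl C) iso_tail).
apply: iso_trans (isoH') _; apply: dunion_iso (iso_refl _).
apply: dlsT; rewrite !laplacianE; apply/cospectral_phi.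
move: phiH; rewrite (phi_iso false isoH') /= !phi_dunion.
by apply: mulIf; apply: phi_neq0.
Qed.

Lemma laplacian_case H : DLS T -> phi false H = phi false (unions ds) ->
  isomorphic H (unions ds).
Proof.
move=> dlsT phiH; have [cs con_cs iso_cs] := components (leqnn (graph_order H)).
have phiE : phi false (unions cs) = phi false (unions ds).
  by rewrite -(phi_iso false iso_cs).
have szE : size cs = size ds.
  rewrite -!mup0_unions // ?phiE //; exact: Forall_tree_like_connected tree_ds.
have tree_cs := cospectral_tree_like con_cs tree_ds szE phiE.
have prodE : (\prod_(C <- cs) graph_order C = n * 2 ^ s)%N.
  by apply/eqP; rewrite -(eqr_nat rat) -prod_ds -!low_unions ?phiE //; apply:
    tree_ds.
have sumE : (\sum_(C <- cs) graph_order C = n + (r + 2 * s))%N.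
  by rewrite -graph_order_unions (phi_graph_order phiE) /= graph_order_dunion
    order_tail.
have [l [Dcs cntl fl]] : exists l : seq (sgraph * bool), [/\ map fst l = cs,
    count snd l = s & all (fun x => x.2 ==> root (phi false x.1) 2) l].
  apply: (choose_flags (P := fun C => root (phi false C) 2)).
  rewrite -mup2_unions // phiE mup2_unions; last exact: tree_ds.
  rewrite /= count_cat !count_nseq root2_complete2 mul1n addnA.
  exact: leq_addl.
have all_fl : List.Forall flagged l by apply: Forall_flagged; rewrite ?Dcs.
have size_l : size l = (r + s).+1 by rewrite -size_ds -szE -Dcs size_map.
rewrite -Dcs big_map in prodE; rewrite -Dcs big_map in sumE.
have prod_part : (\prod_(x <- l) (part x).+1 = n)%N.
  apply/eqP; rewrite -(@eqn_pmul2l (2 ^ s)) ?expn_gt0 //.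
  by rewrite -{1}cntl -flagged_prod // prodE mulnC.
(* The [r + s + 1] components and the [s] flags account for all of [r + 2s] and one unit of [n]. *)
have sum_part : (1 + \sum_(x <- l) 2 ^ x.2 * part x = n)%N.
  by move: sumE; rewrite flagged_sum // size_l cntl; lia.
(* Components with part 0 have order 1 or 2; only those with a positive part enter the equation. *)
pose big := filter (fun x => 0 < part x)%N l.
pose sm := filter (predC (fun x => 0 < part x)%N) l.
have iso_l : isomorphic H (dunion (unions (map fst big)) (unions (map fst sm))).
  by apply: iso_trans iso_cs _; rewrite -Dcs; apply: unions_filter.
have small_sm : List.Forall small (map fst sm).
  apply: Forall_map (Forall_filter _ all_fl) => x [[treex _ ordx] /=].
  rewrite -eqn0Ngt => /eqP part0; split; first exact: treex.1.
  by rewrite ordx part0 muln1; case: x.2.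
have fl_big : List.Forall (fun x => flagged x /\ (0 < part x)%N) big.
  exact: Forall_filter.
have size_big : (size big + size sm = (r + s).+1)%N.
  by rewrite !size_filter count_predC size_l.
have order_sum : (graph_order (unions (map fst big)) +
   graph_order (unions (map fst sm)) = n + (r + 2 * s))%N.
  rewrite -graph_order_dunion -(phi_graph_order (phi_iso false iso_l)).
  by rewrite (phi_graph_order phiH) /= graph_order_dunion order_tail.
have := @parts_cases [seq (part x, x.2) | x <- big].
rewrite all_map filter_all !big_map !big_filter => /(_ isT).
have -> : (\prod_(x <- l | 0 < part x) (part x).+1 = \prod_(x <- l) (part x).+1)%N.
  by rewrite big_mkcond; apply: eq_bigr => x _; case: (part x).
have -> : (\sum_(x <- l | 0 < part x) 2 ^ x.2 * part x =
           \sum_(x <- l) 2 ^ x.2 * part x)%N.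
  by rewrite big_mkcond; apply: eq_bigr => x _; case: (part x); rewrite ?muln0.
rewrite prod_part sum_part => /(_ erefl) cases.
have prod_big : (\prod_(x <- big) (part x).+1 = n)%N.
  by rewrite -prod_part big_filter big_mkcond; apply: eq_bigr => x _; case:
    (part x).
have split_off C cs' : isomorphic (unions (map fst big)) (dunion C (unions cs')) ->
    connected C -> graph_order C = n -> List.Forall small cs' ->
    (size cs').+1 = size big -> isomorphic H (unions ds).
  move=> isoC conC orderC small_cs' szC.
  apply: (split_iso (C := C) (cs := cs' ++ map fst sm)) => //.
  - exact: Forall_cat.
  - by rewrite size_cat size_map; lia.
  apply: iso_trans iso_l _; apply: iso_trans (dunion_iso isoC (iso_refl _)) _.
  apply: iso_trans (iso_sym (dunionA _ _ _)) _; apply: dunion_iso (iso_refl _) _.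
  exact: iso_sym (unions_cat _ _).
clearbody big; case: cases => [t_eq|[b t_eq]|[b t_eq]|t_eq].
(* No positive part: the empty product gives [n = 1], so [T] is small too. *)
- have big0 : big = [::] by case:
  big t_eq {iso_l fl_big size_big order_sum split_off prod_big}.
  rewrite big0 /= in iso_l size_big order_sum prod_big; rewrite big_nil in prod_big.
  apply: iso_trans iso_l _; apply: iso_trans (dunionC _ _) _.
  apply: iso_trans (dunion0 _ (graph_order_complete 0)) _; apply: small_iso => //.
  + by constructor; [split; [exact: treeT.1|rewrite -/n -prod_big]|exact:
    small_tail].
  + by rewrite size_map size_ds -size_big.
  + by move: order_sum;
    rewrite graph_order_complete /= graph_order_dunion order_tail.
- have [x [bigE Dp Du]] : exists x, [/\ big = [:: x], part x = b & x.2 = false].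
    case: big t_eq {iso_l fl_big size_big order_sum split_off prod_big} => [|x
      [|y big]] //.
    by case=> Dp Du; exists x.
  rewrite bigE in fl_big prod_big; have [[treex _ ordx] _] :=
    List.Forall_inv fl_big.
  apply: (split_off x.1 [::]); rewrite ?bigE //; first exact: iso_refl.
    exact: treex.1.
  by rewrite ordx Du mul1n -prod_big big_seq1.
(* The flagged component has order [2 (b + 1) = n]; the unflagged one has part 1, hence order 2. *)
- have [x [y [isoxy sz [flx fly] orderx ordery]]] : exists x y : sgraph * bool,
    [/\ isomorphic (unions (map fst big)) (dunion x.1 (unions [:: y.1])),
        size big = 2%N, flagged x /\ flagged y,
        graph_order x.1 = n & graph_order y.1 = 2%N].
    case: t_eq => /map_pair_inv[x [y [bigE [Dpx Dux] [Dpy Duy]]]];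
      rewrite bigE !big_cons big_nil Dpx Dpy in fl_big prod_big *;
      have [flx _] := List.Forall_inv fl_big;
      have [fly _] := List.Forall_inv (List.Forall_inv_tail fl_big).
      exists x, y; split=> //; first exact: iso_refl.
        by have [_ _ ->] := flx; rewrite Dpx Dux -prod_big expn1 !muln1 mulnC.
      by have [_ _ ->] := fly; rewrite Dpy Duy.
    exists y, x; split=> //; first exact: dunionCA.
      by have [_ _ ->] := fly; rewrite Dpy Duy -prod_big expn1 !muln1.
    by have [_ _ ->] := flx; rewrite Dpx Dux.
  have [treex _ _] := flx; have [treey _ _] := fly.
  apply: (split_off x.1 [:: y.1]) => //; first exact: treex.1.
    by constructor=> //; split; [exact: treey.1|rewrite ordery].
- exfalso; have [x [y [bigE [Dpx Dux] [Dpy Duy]]]] := map_pair_inv t_eq.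
  rewrite bigE in fl_big prod_big iso_l size_big order_sum.
  have [[treex rootx ordx] _] := List.Forall_inv fl_big.
  have [[treey rooty ordy] _] := List.Forall_inv (List.Forall_inv_tail fl_big).
  have n9 : n = 9%N by rewrite -prod_big !big_cons big_nil Dpx Dpy.
  rewrite Dpx Dux in ordx; rewrite Dpy Duy in ordy.
  have [a [c [iso_sm size_sm order_sm]]] := small_unions small_sm.
  move: order_sum; rewrite order_sm /= !graph_order_dunion graph_order_complete.
  rewrite ordx ordy n9 /= => order_sum.
  rewrite size_map in size_sm; rewrite size_sm /= in size_big.
  (* Removing two components of order 6 from both counts leaves one more [K_1] than in the
     target. *)
  have Ea : a = r.+1 by lia.
  have psiE : psi (unions cs) = psi (unions ds).
    apply: (intr_inj (R := algC)); rewrite !psi_spectral //; last exact: tree_ds.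
    by rewrite phiE (phi_graph_order phiE).
  have psiT := psi_ge0 treeT.1; rewrite -/n n9 in psiT; have {}psiT := psiT isT.
  have psiK1 : psi K1 = -6 by rewrite psi_complete.
  have psiK2 : psi K2 = 0 by rewrite psi_complete.
  have psi0 : psi (complete 0) = 0 by rewrite psi_complete.
  have psi_x : psi x.1 = 0 by apply: psi_root2_order6 => //; apply: rootx.
  have psi_y : psi y.1 = 0 by apply: psi_root2_order6 => //; apply: rooty.
  move: psiE; rewrite -(psi_iso iso_cs) (psi_iso iso_l) psi_dunion (psi_iso iso_sm).
  rewrite /= !psi_dunion (psi_iso (unions_cat _ _)) psi_dunion !psi_nseq.
  rewrite psi_x psi_y psi0 psiK1 psiK2 !mul0rn !addr0 !add0r Ea mulrS.
  (* The identity reads [-6 (r + 1) = psi T - 6 r], against [psi T] being nonnegative. *)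
  by move: psiT; set z := psi T; set k := -6 *+ r; lia.
Qed.

Lemma signless_case H : DLS T -> odd n -> s = 1%N ->
  phi true H = phi true (unions ds) -> isomorphic H (unions ds).
Proof.
move=> dlsT odd_n s1 phiH; have [cs con_cs iso_cs] :=
  components (leqnn (graph_order H)).
have phiE : phi true (unions cs) = phi true (unions ds).
  by rewrite -(phi_iso true iso_cs).
have lowE : `|low (phi true (unions cs))| = (n * 2)%:R.
  rewrite phiE phi_true_unions; last exact: tree_ds.
  by rewrite low_unions; [rewrite prod_ds s1|exact: tree_ds].
have szE : size cs = size ds.
  rewrite -mup0_signless_unions // => [|k].
    rewrite phiE phi_true_unions; last exact: tree_ds.
    by rewrite mup0_unions //; apply: Forall_tree_like_connected tree_ds.
  (* The lowest coefficient [2n] is not a multiple of 4, as [n] is odd. *)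
  by rewrite lowE eqr_nat; apply: contraTneq odd_n => nk; apply/negP; lia.
have tree_cs := cospectral_tree_like con_cs tree_ds szE phiE.
apply: laplacian_case => //; rewrite (phi_iso false iso_cs).
by rewrite -!phi_true_unions //; apply: tree_ds.
Qed.
End Main.

Local Close Scope ring_scope.

Theorem theorem3p1 (T : sgraph) (n r s : nat)
    (treeT : is_tree T) (orderT : graph_order T = n) (dlsT : DLS T) :
  DLS (dunion (dunion T (copies r (complete 1))) (copies s (complete 2))) /\
  (~~ (2 %| n) -> s = 1 ->
   DQS (dunion (dunion T (copies r (complete 1))) (copies s (complete 2)))).
Proof.
have treeT' := is_tree_tree_like treeT; have isoG := iso_G T r s.
split=> [H|odd_n s1 H].
  rewrite !laplacianE => /cospectral_phi phiH.
  apply: iso_trans (iso_sym isoG); apply: laplacian_case => //.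
  by rewrite phiH (phi_iso _ isoG).
rewrite !signless_laplacianE => /cospectral_phi phiH.
apply: iso_trans (iso_sym isoG); apply: signless_case => //.
  by move: odd_n; rewrite orderT dvdn2 negbK.
by rewrite phiH (phi_iso _ isoG).
Qed.
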